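(* For any set $I$, let $\mathrm{F_t}(I)$ be the set of all $\mathrm{Cyl}(\mathbb{R}^I)$-measurable functions $f\colon\mathbb{R}^I\to\mathbb{R}$ for which there exist a finite subset $J\subseteq I$ and nonnegative real numbers $(\lambda_j)_{j\in J}$ with $|f|\leq\sum_{j\in J}\lambda_j|\pi_j|$. Then $\mathrm{F_t}(I)=\{f\colon\mathbb{R}^I\to\mathbb{R}\mid f\text{ preserves integrability}\}$, and $\mathrm{F_t}(I)$, with pointwise operations and truncation $\overline{f}=f\land1$, is the Dedekind $\sigma$-complete truncated Riesz space freely generated by the projections $\pi_i\colon\mathbb{R}^I\to\mathbb{R}$ ($i\in I$). The latter means: for every Dedekind $\sigma$-complete truncated Riesz space $G$ and every function $h\colon I\to G$, there is a unique $\sigma$-continuous truncation-preserving Riesz morphism $\varphi\colon\mathrm{F_t}(I)\to G$ such that $\varphi(\pi_i)=h(i)$ for all $i\in I$.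
   Context: $\mathrm{Cyl}(\mathbb{R}^I)$ is the smallest $\sigma$-algebra on $\mathbb{R}^I$ making every projection $\pi_i\colon\mathbb{R}^I\to\mathbb{R}$ measurable. For $p\in[1,+\infty)$ and a measure space $(\Omega,\mathcal{F},\mu)$ (with $\mu$ valued in $[0,+\infty]$), $\mathcal{L}^p(\mu)$ is the set of $\mathcal{F}$-measurable $f\colon\Omega\to\mathbb{R}$ with $\int_\Omega|f|^p\,d\mu<\infty$. A function $\tau\colon\mathbb{R}^I\to\mathbb{R}$ preserves $p$-integrability if for every measure space $(\Omega,\mathcal{F},\mu)$ and every family $(f_i)_{i\in I}$ in $\mathcal{L}^p(\mu)$, the function $x\mapsto\tau((f_i(x))_{i\in I})$ is in $\mathcal{L}^p(\mu)$. This does not depend on $p\in[1,+\infty)$; $\tau$ preserves integrability if it holds for some (equivalently, every) such $p$. For a Riesz space (vector lattice) $G$, $G^+=\{x\in G\mid x\geq0\}$, $f^+=f\lor0$, $f^-=-(f\land 0)$, and $\omega=\{0,1,2,\dots\}$. A truncated Riesz space is a Riesz space $G$ with a unary operation $\overline{\,\cdot\,}\colon G\to G$ (truncation) such that: (T1) $\overline{f}=\overline{f^+}-f^-$ for all $f\in G$; (T2) $\overline{f}\in G^+$ for all $f\in G^+$; (T3) $f\land\overline{g}\leq\overline{f}\leq f$ for all $f,g\in G^+$; (T4) for $f\in G^+$, $\overline f=0$ implies $f=0$; (T5) for $f\in G^+$, if $nf=\overline{nf}$ for every $n\in\omega$ then $f=0$. A poset is Dedekind $\sigma$-complete if every nonempty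 countable subset that has an upper bound has a supremum. A map between posets is $\sigma$-continuous if it preserves all existing suprema of nonempty countable subsets. A Riesz morphism is a linear lattice homomorphism. *)

(* Defs.v *)
From HB Require Import structures.
From mathcomp Require Import all_boot all_order all_algebra finmap.
From mathcomp Require Import all_classical all_reals all_analysis.
From mathcomp Require Import measurable_realfun.
Import Order.TTheory GRing.Theory Num.Theory.
Import numFieldNormedType.Exports.

Set Implicit Arguments.
Unset Strict Implicit.
Unset Printing Implicit Defensive.

Local Open Scope classical_set_scope.
Local Open Scope ring_scope.

(* [Num.POrderedZmodule] has the display [ring_display], which only selects the
   notations of [ring_scope]. The lattice operations are not those of
   [Order.Lattice] because Hierarchy Builder rejects the join of that structure
   with [GRing.Lmodule], which would have to precede [Num.RealDomain]. *)
HB.mixin Record POrderedLmodule_isRiesz (R : realType) V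
    of Num.POrderedZmodule V & GRing.Lmodule R V := {
  rmeet : V -> V -> V ;
  rjoin : V -> V -> V ;
  rlexI : forall x y z : V, (x <= rmeet y z) = (x <= y) && (x <= z) ;
  rleUx : forall x y z : V, (rjoin x y <= z) = (x <= z) && (y <= z) ;
  rieszD2r : forall x y z : V, x <= y -> x + z <= y + z ;
  rieszZ_ge0 : forall (a : R) (x : V), 0 <= a -> 0 <= x -> 0 <= a *: x
}.

#[short(type="rieszType")]
HB.structure Definition Riesz (R : realType) :=
  { V of Num.POrderedZmodule V & GRing.Lmodule R V
       & POrderedLmodule_isRiesz R V }.

Section RieszParts.
Context (R : realType) (V : rieszType R).

Definition rpos (f : V) : V := rjoin f 0.
Definition rneg (f : V) : V := - rmeet f 0.

End RieszParts.

HB.mixin Record Riesz_isTruncated (R : realType) V of Riesz R V := {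
  trunc : V -> V ;
  trunc_pos_neg : forall f : V, trunc f = trunc (rpos f) - rneg f ;
  trunc_ge0 : forall f : V, 0 <= f -> 0 <= trunc f ;
  trunc_bounds : forall f g : V, 0 <= f -> 0 <= g ->
    rmeet f (trunc g) <= trunc f /\ trunc f <= f ;
  trunc_eq0 : forall f : V, 0 <= f -> trunc f = 0 -> f = 0 ;
  trunc_archi : forall f : V, 0 <= f ->
    (forall n : nat, f *+ n = trunc (f *+ n)) -> f = 0
}.

#[short(type="truncRieszType")]
HB.structure Definition TruncRiesz (R : realType) :=
  { V of Riesz R V & Riesz_isTruncated R V }.

Definition sigma_complete (d : Order.disp_t) (P : porderType d) : Prop :=
  forall A : set P, A !=set0 -> countable A -> has_ubound A ->
    supremums A !=set0.

Definition sigma_continuous (d d' : Order.disp_t)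
    (P : porderType d) (Q : porderType d') (phi : P -> Q) : Prop :=
  forall (A : set P) (s : P), A !=set0 -> countable A ->
    supremums A s -> supremums (phi @` A) (phi s).

Definition riesz_morphism (R : realType) (V W : rieszType R)
    (phi : V -> W) : Prop :=
  [/\ linear phi, {morph phi : f g / rmeet f g}
    & {morph phi : f g / rjoin f g}].

Definition trunc_preserving (R : realType) (V W : truncRieszType R)
    (phi : V -> W) : Prop :=
  {morph phi : f / trunc f}.

Section Ft.
Context (R : realType) (I : Type).

Definition cylinders : set (set (I -> R)) :=
  \bigcup_(i in [set: I])
    preimage_set_system setT (fun x : I -> R => x i) measurable.

Definition Cyl := g_sigma_algebraType cylinders.

(* [{classic I}] is [I] with the equality and choice provided by classical
   logic, so that its finite subsets form the type [{fset {classic I}}]. *)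
Definition Ft_set : set ((I -> R) -> R) :=
  [set f | measurable_fun [set: Cyl] (f : Cyl -> R) /\
    exists (J : {fset {classic I}}) (lam : {classic I} -> R),
      (forall j, j \in J -> 0 <= lam j) /\
      forall x : I -> R, `|f x| <= \sum_(j <- J) lam j * `|x j|].

Definition Ft_pred : {pred ((I -> R) -> R)} := mem Ft_set.

Record Ft := MkFt { Ft_val :> (I -> R) -> R ; _ : Ft_val \in Ft_pred }.

HB.instance Definition _ := [isSub for Ft_val].
HB.instance Definition _ := [Choice of Ft by <:].

Lemma Ft_bound_fset (J K : {fset {classic I}}) (lam : {classic I} -> R)
    (x : I -> R) : (forall j, j \in J -> 0 <= lam j) ->
  \sum_(j <- J) lam j * `|x j| <=
  \sum_(j <- (J `|` K)%fset) (if j \in J then lam j else 0) * `|x j|.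
Proof.
move=> lam0; rewrite [leRHS](bigID (mem J))/=.
have -> : \sum_(j <- (J `|` K)%fset | j \in J)
    (if j \in J then lam j else 0) * `|x j| = \sum_(j <- J) lam j * `|x j|.
  rewrite -big_filter; transitivity
    (\sum_(j <- J) (if j \in J then lam j else 0) * `|x j|).
    apply: perm_big; apply: uniq_perm; rewrite ?filter_uniq ?fset_uniq// => j.
    by rewrite mem_filter in_fsetU; case: (j \in J).
  by apply: eq_big_seq => j ->.
by rewrite lerDl sumr_ge0// => j /negbTE ->; rewrite mul0r.
Qed.

Lemma Ft_submod : submod_closed Ft_pred.
Proof.
split.
  rewrite inE; split; first exact: measurable_cst.
  by exists fset0, (fun=> 0); split => // x; rewrite normr0 sumr_ge0.
move=> a f g; rewrite !inE => -[mf [J [l [l0 fl]]]] [mg [K [m [m0 gm]]]].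
split.
  by apply: measurable_funD => //; apply: measurable_funM => //;
    exact: measurable_cst.
exists (J `|` K)%fset, (fun j => `|a| * (if j \in J then l j else 0)
  + (if j \in K then m j else 0)); split.
  move=> j _; apply: addr_ge0; first apply: mulr_ge0 => //.
    by case: ifP => // /l0.
  by case: ifP => // /m0.
move=> x; rewrite (le_trans (ler_normD _ _))//.
under eq_bigr do rewrite mulrDl -mulrA.
rewrite big_split/= -big_distrr/= lerD//.
  rewrite [X in `|X|](_ : _ = a * f x)// normrM ler_wpM2l//.
  exact: le_trans (fl x) (Ft_bound_fset _ _ _).
by rewrite fsetUC; exact: le_trans (gm x) (Ft_bound_fset _ _ _).
Qed.

HB.instance Definition _ := GRing.isSubmodClosed.Build R _ Ft_pred Ft_submod.
HB.instance Definition _ := [SubChoice_isSubLmodule of Ft by <:].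

Lemma Ft_le_normD (f g h : (I -> R) -> R) : f \in Ft_pred -> g \in Ft_pred ->
  measurable_fun [set: Cyl] (h : Cyl -> R) ->
  (forall x, `|h x| <= `|f x| + `|g x|) -> h \in Ft_pred.
Proof.
rewrite !inE => -[mf [J [l [l0 fl]]]] [mg [K [m [m0 gm]]]] mh hfg.
split => //.
exists (J `|` K)%fset, (fun j => (if j \in J then l j else 0)
  + (if j \in K then m j else 0)); split.
  move=> j _; apply: addr_ge0.
    by case: ifP => // /l0.
  by case: ifP => // /m0.
move=> x; rewrite (le_trans (hfg x))//.
under eq_bigr do rewrite mulrDl.
rewrite big_split/= lerD//.
  exact: le_trans (fl x) (Ft_bound_fset _ _ _).
by rewrite fsetUC; exact: le_trans (gm x) (Ft_bound_fset _ _ _).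
Qed.

HB.instance Definition _ :=
  [SubChoice_isSubPOrder of Ft by <: with ring_display].

Lemma Ft_le (f g : Ft) : (f <= g) = `[< forall x, f x <= g x >].
Proof. by rewrite -Order.le_val. Qed.

Lemma Ft_meet (f g : Ft) : f \min g \in Ft_pred.
Proof.
apply: (Ft_le_normD (valP f) (valP g)) => [|x /=].
  have := valP f; have := valP g; rewrite !inE => -[mg _] [mf _].
  exact: (measurable_minr mf mg).
by rewrite minEle; case: ifP => _; rewrite ?lerDl ?lerDr.
Qed.

Lemma Ft_join (f g : Ft) : f \max g \in Ft_pred.
Proof.
apply: (Ft_le_normD (valP f) (valP g)) => [|x /=].
  have := valP f; have := valP g; rewrite !inE => -[mg _] [mf _].
  exact: (measurable_maxr mf mg).
by rewrite maxEle; case: ifP => _; rewrite ?lerDl ?lerDr.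
Qed.

Lemma Ft_lexI (f g h : Ft) : (f <= MkFt (Ft_meet g h)) = (f <= g) && (f <= h).
Proof.
rewrite !Ft_le; apply/asboolP/andP => [fgh|[/asboolP fg /asboolP fh] x /=].
  by split; apply/asboolP => x; have := fgh x; rewrite /= le_min => /andP[].
by rewrite le_min fg fh.
Qed.

Lemma Ft_leUx (f g h : Ft) : (MkFt (Ft_join f g) <= h) = (f <= h) && (g <= h).
Proof.
rewrite !Ft_le; apply/asboolP/andP => [fgh|[/asboolP fg /asboolP fh] x /=].
  by split; apply/asboolP => x; have := fgh x; rewrite /= ge_max => /andP[].
by rewrite ge_max fg fh.
Qed.

Lemma Ft_leD2r (f g h : Ft) : f <= g -> f + h <= g + h.
Proof.
by rewrite !Ft_le => /asboolP fg; apply/asboolP => x /=; rewrite lerD2r.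
Qed.

Lemma Ft_scale_ge0 (a : R) (f : Ft) : 0 <= a -> 0 <= f -> 0 <= a *: f.
Proof.
rewrite !Ft_le => a0 /asboolP f0; apply/asboolP => x.
exact: mulr_ge0 (f0 x).
Qed.

HB.instance Definition _ := POrderedLmodule_isRiesz.Build R Ft
  Ft_lexI Ft_leUx Ft_leD2r Ft_scale_ge0.

Lemma Ft_trunc_subproof (f : Ft) : (fun x => Num.min (f x) 1) \in Ft_pred.
Proof.
apply: (Ft_le_normD (valP f) (valP f)) => [|x /=].
  have := valP f; rewrite inE => -[mf _].
  by apply: (measurable_minr mf); exact: measurable_cst.
rewrite minElt; case: ifPn => [_|]; first by rewrite lerDl.
rewrite -leNgt normr1 => f1; rewrite -[leLHS]addr0 lerD//.
exact: le_trans f1 (ler_norm _).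
Qed.

Definition Ft_trunc (f : Ft) : Ft := MkFt (Ft_trunc_subproof f).

Lemma Ft_trunc_pos_neg (f : Ft) : Ft_trunc f = Ft_trunc (rpos f) - rneg f.
Proof.
apply/val_inj/funext => x /=.
change (Num.min (f x) 1 =
  Num.min (Num.max (f x) 0) 1 - - Num.min (f x) 0).
rewrite opprK; have [f0|f0] := leP (f x) 0; have [f1|f1] := leP (f x) 1.
- by rewrite (min_idPl ler01) add0r.
- by have := lt_le_trans f1 f0; rewrite ltNge ler01.
- by rewrite addr0.
- by rewrite addr0.
Qed.

Lemma Ft_trunc_ge0 (f : Ft) : 0 <= f -> 0 <= Ft_trunc f.
Proof.
rewrite !Ft_le => /asboolP f0; apply/asboolP => x /=.
by rewrite le_min ler01 andbT; exact: f0.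
Qed.

Lemma Ft_trunc_bounds (f g : Ft) : 0 <= f -> 0 <= g ->
  rmeet f (Ft_trunc g) <= Ft_trunc f /\ Ft_trunc f <= f.
Proof.
move=> _ _; rewrite !Ft_le; split; apply/asboolP => x /=.
  by rewrite le_min !ge_min !lexx !orbT.
by rewrite ge_min lexx.
Qed.

Lemma Ft_trunc_eq0 (f : Ft) : 0 <= f -> Ft_trunc f = 0 -> f = 0.
Proof.
rewrite Ft_le => /asboolP f0 /(congr1 val) tf0; apply/val_inj/funext => x.
have /= := congr1 (@^~ x) tf0; rewrite minElt; case: ifP => // _ /eqP.
by rewrite oner_eq0.
Qed.

Lemma Ft_mulrn (f : Ft) n x : (f *+ n) x = f x *+ n.
Proof. by elim: n => // n IHn; rewrite !mulrS -IHn. Qed.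

Lemma Ft_trunc_archi (f : Ft) : 0 <= f ->
  (forall n : nat, f *+ n = Ft_trunc (f *+ n)) -> f = 0.
Proof.
rewrite Ft_le => /asboolP f0 nf; apply/val_inj/funext => x.
have f_le1 n : f x *+ n <= 1.
  have := congr1 (@^~ x) (congr1 val (nf n)); rewrite /= Ft_mulrn => ->.
  by rewrite ge_min lexx orbT.
have fx_ge0 : 0 <= f x := f0 x; change (f x = 0).
move: fx_ge0; rewrite le_eqVlt => /orP[/eqP<-//|fx0].
have := f_le1 (Num.truncn (f x)^-1).+1; rewrite leNgt => /negP[].
by rewrite -mulr_natl -ltr_pdivrMr// div1r truncnS_gt.
Qed.

HB.instance Definition _ := Riesz_isTruncated.Build R Ft
  Ft_trunc_pos_neg Ft_trunc_ge0 Ft_trunc_bounds Ft_trunc_eq0 Ft_trunc_archi.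

Lemma Ft_proj_subproof (i : I) : (fun x : I -> R => x i) \in Ft_pred.
Proof.
rewrite inE; split.
  move=> _ B mB; apply: sub_sigma_algebra; exists i => //.
  by exists B.
exists [fset (i : {classic I})]%fset, (fun=> 1); split => // x.
by rewrite big_seq_fset1 mul1r.
Qed.

Definition Ft_proj (i : I) : Ft := MkFt (Ft_proj_subproof i).

(* A [measurableType] is nonempty; an empty measure space imposes no condition,
   as every function on it belongs to every L^p. *)
Definition preserves_p_integrability (p : R) (tau : (I -> R) -> R) : Prop :=
  forall (d : measure_display) (T : measurableType d)
    (mu : {measure set T -> \bar R}) (f : I -> T -> R),
    (forall i, f i \in Lfun mu p%:E) ->
    (fun x => tau (fun i => f i x)) \in Lfun mu p%:E.

Definition preserves_integrability (tau : (I -> R) -> R) : Prop :=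
  exists2 p : R, 1 <= p & preserves_p_integrability p tau.

End Ft.

Arguments cylinders : clear implicits.
Arguments Cyl : clear implicits.
Arguments Ft_set : clear implicits.
Arguments Ft_pred : clear implicits.
Arguments Ft : clear implicits.
Arguments Ft_proj R {I} i.

(* Main.v *)
(* Elements of [Ft R I] are the values of terms built from the projections with
   the vector lattice operations, truncation and countable bounded suprema:
   for a term [e >= 0], the sets [B] such that [e] restricted to [B] is the
   value of a term form a sigma-algebra containing the cylinders, and
   [0 <= f <= e] is the supremum over rational [q >= 0] of [q e] restricted to
   [{f > q e}]. Hence uniqueness; existence amounts to showing that an identity
   between terms that holds in [R] holds in every Dedekind sigma-complete [G].

   This is a Rasiowa-Sikorski (Baire category) argument. If the value
   [g >= 0] of a term is not [0] in [G], truncation yields [u <> 0] below a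
   multiple of [g] that acts as a constant function [1] on its support. A
   decreasing sequence of nonzero elements below [u], generic for countably
   many requirements, gives to the value of each subterm a real number,
   compatibly with the operations and with the countably many suprema
   involved: it is a point of [I -> R] at which the term is positive.

   For the integrability part, a function preserving p-integrability is
   measurable (test on the zero measure), so it depends on countably many
   coordinates, and a suitable weighted measure on [nat] shows it is bounded
   as required. *)
Require Import Defs.
From HB Require Import structures.
From mathcomp Require Import all_boot all_order all_algebra finmap.
From mathcomp Require Import all_classical all_reals all_analysis.
From mathcomp Require Import measurable_realfun.
Import Order.TTheory GRing.Theory Num.Theory.
Import numFieldNormedType.Exports.

Local Open Scope classical_set_scope.
Local Open Scope ring_scope.

Set Implicit Arguments.
Unset Strict Implicit.
Unset Printing Implicit Defensive.

(** * Riesz spaces *)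

Section RieszTheory.
Context (R : realType) (V : rieszType R).
Implicit Types (x y z b m : V) (a : R).

Lemma riesz_leD2r z x y : (x + z <= y + z) = (x <= y).
Proof.
apply/idP/idP => [|]; last exact: rieszD2r.
by move/(rieszD2r _ _ (- z)); rewrite !addrK.
Qed.

Lemma riesz_leD x y x' y' : x <= y -> x' <= y' -> x + x' <= y + y'.
Proof.
move=> xy xy'; apply: (@le_trans _ _ (y + x')); first exact: rieszD2r.
by rewrite ![y + _]addrC; exact: rieszD2r.
Qed.

Lemma riesz_subr_ge0 x y : (0 <= y - x) = (x <= y).
Proof. by rewrite -(riesz_leD2r x 0) add0r subrK. Qed.

Lemma riesz_subr_le0 x y : (x - y <= 0) = (x <= y).
Proof. by rewrite -(riesz_leD2r y (x - y)) add0r subrK. Qed.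

Lemma riesz_leN2 x y : (- x <= - y) = (y <= x).
Proof. by rewrite -(riesz_subr_ge0 (- x)) opprK addrC riesz_subr_ge0. Qed.

Lemma riesz_oppr_le0 x : (- x <= 0) = (0 <= x).
Proof. by rewrite -{1}oppr0 riesz_leN2. Qed.

Lemma riesz_leBlDr x y z : (x - z <= y) = (x <= y + z).
Proof. by rewrite -(riesz_leD2r z (_ - _)) subrK. Qed.

Lemma riesz_leBrDr x y z : (x <= y - z) = (x + z <= y).
Proof. by rewrite -(riesz_leD2r z x) subrK. Qed.

Lemma rmeet_lel x y : rmeet x y <= x.
Proof. by have := lexx (rmeet x y); rewrite rlexI => /andP[]. Qed.

Lemma rmeet_ler x y : rmeet x y <= y.
Proof. by have := lexx (rmeet x y); rewrite rlexI => /andP[]. Qed.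

Lemma rmeet_glb x y z : z <= x -> z <= y -> z <= rmeet x y.
Proof. by rewrite rlexI => -> ->. Qed.

Lemma rjoin_gel x y : x <= rjoin x y.
Proof. by have := lexx (rjoin x y); rewrite rleUx => /andP[]. Qed.

Lemma rjoin_ger x y : y <= rjoin x y.
Proof. by have := lexx (rjoin x y); rewrite rleUx => /andP[]. Qed.

Lemma rjoin_lub x y z : x <= z -> y <= z -> rjoin x y <= z.
Proof. by rewrite rleUx => -> ->. Qed.

Lemma rmeetC x y : rmeet x y = rmeet y x.
Proof. by apply/eqP; rewrite eq_le !rlexI !rmeet_lel !rmeet_ler. Qed.

Lemma rjoinC x y : rjoin x y = rjoin y x.
Proof. by apply/eqP; rewrite eq_le !rleUx !rjoin_gel !rjoin_ger. Qed.

Lemma rmeet_idl x y : x <= y -> rmeet x y = x.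
Proof. by move=> xy; apply/eqP; rewrite eq_le rmeet_lel rmeet_glb. Qed.

Lemma rmeet_mono x y x' y' : x <= y -> x' <= y' -> rmeet x x' <= rmeet y y'.
Proof.
move=> xy xy'; apply: rmeet_glb; first exact: le_trans (rmeet_lel _ _) xy.
exact: le_trans (rmeet_ler _ _) xy'.
Qed.

Lemma rmeetD z x y : rmeet x y + z = rmeet (x + z) (y + z).
Proof.
apply/eqP; rewrite eq_le rlexI !riesz_leD2r rmeet_lel rmeet_ler/=.
by rewrite -riesz_leBlDr rlexI !riesz_leBlDr rmeet_lel rmeet_ler.
Qed.

Lemma rjoinD z x y : rjoin x y + z = rjoin (x + z) (y + z).
Proof.
apply/eqP; rewrite eq_le rleUx !riesz_leD2r rjoin_gel rjoin_ger !andbT.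
by rewrite -riesz_leBrDr rleUx !riesz_leBrDr rjoin_gel rjoin_ger.
Qed.

Lemma rmeetN x y : rmeet x y = - rjoin (- x) (- y).
Proof.
apply/eqP; rewrite eq_le; apply/andP; split.
  rewrite -riesz_leN2 opprK; apply: rjoin_lub; rewrite riesz_leN2.
    exact: rmeet_lel.
  exact: rmeet_ler.
apply: rmeet_glb; rewrite -riesz_leN2 opprK.
  exact: rjoin_gel.
exact: rjoin_ger.
Qed.

Lemma rmeetE x y : rmeet x y = x + y - rjoin x y.
Proof.
have := rjoinD (x + y) (- x) (- y).
rewrite addKr [- y + _]addrC addrK [in RHS]rjoinC => <-.
by rewrite rmeetN opprD addrCA subrr addr0.
Qed.

(** Infinite distributivity: since [rmeet x b = x + b - rjoin x b] and [rjoin x b <= rjoin s b],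
    every [x] in [A] lies below [m + rjoin s b - b], a bound independent of [x]. *)
Lemma rmeet_sup (A : set V) s b m : supremums A s ->
  (forall x, A x -> rmeet x b <= m) -> rmeet s b <= m.
Proof.
move=> [As sA] Am; rewrite rmeetE riesz_leBlDr -riesz_leBrDr; apply: sA => x Ax.
rewrite riesz_leBrDr -riesz_leBlDr; apply: le_trans (Am x Ax).
rewrite rmeetE; apply: riesz_leD => //; rewrite riesz_leN2.
by rewrite rleUx rjoin_ger (le_trans (As _ Ax)) ?rjoin_gel.
Qed.

Lemma supremumsD (A : set V) s z : supremums A s ->
  supremums ((fun x => x + z) @` A) (s + z).
Proof.
move=> [As sA]; split => [_ [x Ax <-]|t At].
  by rewrite riesz_leD2r As.
rewrite -riesz_leBrDr; apply: sA => x Ax; rewrite riesz_leBrDr.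
by apply: At; exists x.
Qed.

(* [x <= 0] on the part of the space where [b > 0] *)
Definition nonpos_on b x := rmeet x b <= 0.

Lemma nonpos_on_le b x y : x <= y -> nonpos_on b y -> nonpos_on b x.
Proof. by move=> xy; apply: le_trans; exact: rmeet_mono. Qed.

Lemma nonpos_on_sub b b' x : b' <= b -> nonpos_on b x -> nonpos_on b' x.
Proof. by move=> bb'; apply: le_trans; exact: rmeet_mono. Qed.

Lemma nonpos_on_le0 b x : x <= 0 -> nonpos_on b x.
Proof. exact: le_trans (rmeet_lel _ _). Qed.

Lemma nonpos_on_join b x y :
  nonpos_on b x -> nonpos_on b y -> nonpos_on b (rjoin x y).
Proof.
move=> bx by_; apply: (@rmeet_sup [set x; y]).
  split=> [z [->|->]|z zxy]; rewrite ?rjoin_gel ?rjoin_ger//.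
  by apply: rjoin_lub; apply: zxy; [left|right].
by move=> z [->|->].
Qed.

(** With [X] and [Y] the positive parts of [x] and [y], [rmeet (X + Y) b - X] is below both [Y] and
    [b], hence [<= 0]; so [rmeet (X + Y) b <= rmeet X b <= 0]. *)
Lemma nonpos_onD b x y : 0 <= b ->
  nonpos_on b x -> nonpos_on b y -> nonpos_on b (x + y).
Proof.
move=> b0 bx by_.
have b00 : nonpos_on b 0 by exact: nonpos_on_le0.
have bx0 := nonpos_on_join bx b00; have by0 := nonpos_on_join by_ b00.
apply: (@nonpos_on_le _ _ (rjoin x 0 + rjoin y 0)).
  by apply: riesz_leD; exact: rjoin_gel.
apply: (le_trans _ bx0); apply: rmeet_glb; last exact: rmeet_ler.
rewrite -[leRHS]add0r -riesz_leBlDr; apply: (le_trans _ by0).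
apply: rmeet_glb.
  by rewrite riesz_leBlDr addrC; exact: rmeet_lel.
rewrite riesz_leBlDr; apply: le_trans (rmeet_ler _ _) _.
by rewrite -[leLHS]addr0; apply: riesz_leD => //; exact: rjoin_ger.
Qed.

Lemma riesz_scale_ler a x y : 0 <= a -> x <= y -> a *: x <= a *: y.
Proof.
by move=> a0 xy; rewrite -riesz_subr_ge0 -scalerBr rieszZ_ge0// riesz_subr_ge0.
Qed.

Lemma riesz_scale_lel a a' x : 0 <= x -> a <= a' -> a *: x <= a' *: x.
Proof.
by move=> x0 aa; rewrite -riesz_subr_ge0 -scalerBl rieszZ_ge0// subr_ge0.
Qed.

(** [a *: x] is below a natural multiple of the positive part of [x], which reduces the claim to
    sums. *)
Lemma nonpos_onZ a b x : 0 <= a -> 0 <= b -> nonpos_on b x ->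
  nonpos_on b (a *: x).
Proof.
move=> a0 b0 bx; have b00 : nonpos_on b 0 by exact: nonpos_on_le0.
apply: (@nonpos_on_le _ _ ((rjoin x 0) *+ (Num.truncn a).+1)).
  apply: (@le_trans _ _ (a *: rjoin x 0)).
    by apply: riesz_scale_ler => //; exact: rjoin_gel.
  by rewrite -scaler_nat riesz_scale_lel ?rjoin_ger// ltW// truncnS_gt.
elim: (_.+1) => [|n IHn]; first exact: nonpos_on_le0.
by rewrite mulrS; apply: nonpos_onD => //; exact: nonpos_on_join.
Qed.

Lemma nonpos_on_self a b : 0 <= b -> 0 < a -> nonpos_on b (a *: b) -> b = 0.
Proof.
move=> b0 a0 /(@nonpos_onZ a^-1)-/(_ (ltW _) b0).
rewrite invr_gt0 a0 scalerA mulVf ?gt_eqF// scale1r => /(_ isT).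
by rewrite /nonpos_on rmeet_idl// => b0'; apply/eqP; rewrite eq_le b0 b0'.
Qed.

Lemma riesz_mulrn_ge0 x n : 0 <= x -> 0 <= x *+ n.
Proof. by move=> x0; rewrite -scaler_nat rieszZ_ge0. Qed.

Lemma sigma_complete_seq (f : nat -> V) z : sigma_complete V ->
  (forall n, f n <= z) -> exists s, supremums (range f) s.
Proof.
move=> sV fz; apply: sV; first by exists (f 0); exists 0.
  exact: card_image_le.
by exists z => _ [n _ <-].
Qed.

(** The supremum [s] of the multiples of [x] also bounds their shifts by [x], so [s <= s - x]. *)
Lemma sigma_complete_archi x z : sigma_complete V -> 0 <= x ->
  (forall n, x *+ n <= z) -> x = 0.
Proof.
move=> sV x0 xz; have [s [xs sx]] := sigma_complete_seq sV xz.
have: s <= s - x.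
  apply: sx => _ [n _ <-]; rewrite riesz_leBrDr -mulrSr.
  by apply: xs; exists n.+1.
rewrite riesz_leBrDr -[leRHS]addr0 ![s + _]addrC riesz_leD2r => x0'.
by apply/eqP; rewrite eq_le x0 x0'.
Qed.

End RieszTheory.

(** * Disjointness of positive and negative parts *)

Section RieszDisjoint.
Context (R : realType) (V : rieszType R).
Implicit Types (x y b d : V).

Lemma rmeet_pos_neg x : rmeet (rjoin x 0) (rjoin (- x) 0) = 0.
Proof.
have xE : rjoin x 0 - rjoin (- x) 0 = x.
  apply/eqP; rewrite subr_eq addrC; apply/eqP.
  by rewrite rjoinD addNr add0r rjoinC.
(* Subtracting the negative part turns the claim into [rmeet x 0 = - rjoin (- x) 0]. *)
apply: (@addIr _ (- rjoin (- x) 0)); rewrite add0r rmeetD subrr xE.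
by rewrite rmeetN oppr0.
Qed.

(** [rmeet (rjoin x 0) b] is the piece of [b] on which [x > 0]; the density arguments shrink [b] to
    such a piece. *)
Lemma nonpos_on_pos x b : nonpos_on (rmeet (rjoin x 0) b) (- x).
Proof.
rewrite /nonpos_on -[leRHS](rmeet_pos_neg x) [leLHS]rmeetC; apply: rmeet_mono.
  exact: rmeet_lel.
exact: rjoin_gel.
Qed.

Lemma nonpos_on_pos_neq0 x b : 0 <= b -> ~ nonpos_on b x ->
  [/\ 0 <= rmeet (rjoin x 0) b, rmeet (rjoin x 0) b <> 0
    & rmeet (rjoin x 0) b <= b].
Proof.
move=> b0 bx; split; [|move=> xb|exact: rmeet_ler].
  by apply: rmeet_glb => //; exact: rjoin_ger.
by apply: bx; rewrite /nonpos_on -xb; apply: rmeet_mono => //; exact: rjoin_gel.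
Qed.

(** [d <= x *+ n] puts the support of [d] where [x > 0], so [x <= 0] on that support leaves only
    [d = 0]. *)
Lemma nonpos_on_mulrn_le d x n : 0 <= d -> d <= x *+ n -> nonpos_on d x ->
  d = 0.
Proof.
move=> d0 dx ndx; apply/eqP; rewrite eq_le d0 andbT.
have : nonpos_on d d; last by rewrite /nonpos_on rmeet_idl.
by apply: (nonpos_on_le dx); rewrite -scaler_nat; exact: nonpos_onZ.
Qed.

End RieszDisjoint.

(** * Truncation and local units *)

Section LocalUnit.
Context (R : realType) (V : truncRieszType R).
Implicit Types (f g u w : V).

Lemma trunc_mono f g : 0 <= f -> f <= g -> trunc f <= trunc g.
Proof.
move=> f0 fg; have g0 := le_trans f0 fg.
apply: le_trans (trunc_bounds _ _ g0 f0).1; apply: rmeet_glb => //.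
exact: le_trans (trunc_bounds _ _ f0 f0).2 fg.
Qed.

(* [(g - trunc g) *+ k] lives where [g > 1], where its truncation is at most
   [1 <= g]. *)
Lemma trunc_excess_le g k : 0 <= g -> trunc ((g - trunc g) *+ k) <= g.
Proof.
move=> g0; set w := g - trunc g; set a := trunc _.
have w0 : 0 <= w by rewrite riesz_subr_ge0 (trunc_bounds _ _ g0 g0).2.
have kw0 : 0 <= w *+ k by exact: riesz_mulrn_ge0.
have a_le : a <= w *+ k by exact: (trunc_bounds _ _ kw0 kw0).2.
set d := rjoin (a - g) 0.
(* By (T3) [rmeet g a <= trunc g], so [w] is below the positive part of [g - a], which is disjoint
   from [d]. *)
have wd : nonpos_on d w.
  rewrite /nonpos_on -[leRHS](rmeet_pos_neg (- (a - g))) opprK.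
  apply: rmeet_mono => //.
  have : rmeet g a <= trunc g by exact: (trunc_bounds _ _ g0 kw0).1.
  rewrite -riesz_leN2 => /(@riesz_leD _ _ g g _ _ (lexx g)) /le_trans; apply.
  by rewrite rmeetN opprK addrC rjoinD addNr rjoinC opprB addrC.
have d0 : d = 0.
  apply: (@nonpos_on_mulrn_le _ _ _ w k) => //; first exact: rjoin_ger.
  apply: rjoin_lub => //; apply: le_trans a_le.
  by rewrite riesz_leBlDr -{1}[a]addr0; exact: riesz_leD.
by rewrite -riesz_subr_le0 -d0; exact: rjoin_gel.
Qed.

(** On the support of [u], truncation is the meet with [u]: the lower bound holds everywhere, the
    upper one only where [u > 0]. So [u] stands in for a constant [1] that the space need not
    contain. *)
Definition local_unit u := 0 <= u /\
  forall f, 0 <= f -> rmeet f u <= trunc f /\ nonpos_on u (trunc f - u).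

(** [u] is the indicator of [{g *+ n > 1}], with [n] from (T5): it is the supremum of the truncated
    multiples of the excess [w], which stay below [g *+ n] by [trunc_excess_le]. *)
Lemma local_unit_exists g : sigma_complete V -> 0 <= g -> g <> 0 ->
  exists (u : V) (n : nat), [/\ local_unit u, u <> 0 & u <= g *+ n].
Proof.
move=> sV g0 gN0.
have [n ng] : exists n, g *+ n <> trunc (g *+ n).
  by apply: contra_notP gN0 => /forallNP ng; apply: trunc_archi => // n;
    apply: contra_notP (ng n).
have gn0 : 0 <= g *+ n by exact: riesz_mulrn_ge0.
set w := g *+ n - trunc (g *+ n).
have w0 : 0 <= w by rewrite riesz_subr_ge0 (trunc_bounds _ _ gn0 gn0).2.
have kw0 k : 0 <= w *+ k by exact: riesz_mulrn_ge0.
have [u us] : exists u, supremums (range (fun k => trunc (w *+ k))) u.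
  apply: (@sigma_complete_seq _ _ _ (g *+ n)) => // k.
  exact: trunc_excess_le.
have [ub lub] := us.
have lu k : trunc (w *+ k) <= u by apply: ub; exists k.
exists u, n; split.
- split; first by apply: le_trans (lu 0%N); exact: trunc_ge0.
  move=> f f0; split.
    rewrite rmeetC; apply: (rmeet_sup us) => _ [k _ <-].
    by rewrite rmeetC; exact: (trunc_bounds _ _ f0 (kw0 k)).1.
  (* Adding [u] turns the claim into [rmeet (u + u) (trunc f) <= u]. Distributivity reduces [u + u]
     to [trunc (w *+ l) + trunc (w *+ k)], where (T3) gives the bound [trunc (w *+ (l + k))]. *)
  rewrite /nonpos_on -(riesz_leD2r u) add0r rmeetD subrK rmeetC.
  apply: (rmeet_sup (supremumsD u us)) => _ [_ [k _ <-] <-]; rewrite addrC.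
  apply: (rmeet_sup (supremumsD _ us)) => _ [_ [l _ <-] <-].
  apply: le_trans (lu (l + k)%N).
  have x0 : 0 <= trunc (w *+ l) + trunc (w *+ k).
    by rewrite -[0]addr0; apply: riesz_leD; exact: trunc_ge0.
  apply: le_trans (trunc_bounds _ _ x0 f0).1 _; apply: trunc_mono => //.
  rewrite mulrnDr; apply: riesz_leD;
    exact: (trunc_bounds _ _ (kw0 _) (kw0 _)).2.
- move=> u0; apply: ng; apply/eqP; rewrite -subr_eq0; apply/eqP.
  apply: trunc_eq0 => //; apply/eqP; rewrite eq_le trunc_ge0// andbT.
  by have := lu 1; rewrite mulr1n u0.
- by apply: lub => _ [k _ <-]; exact: trunc_excess_le.
Qed.

Lemma local_unit_trunc u f : local_unit u -> 0 <= f ->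
  nonpos_on u (trunc f - rmeet f u).
Proof.
move=> [u0 uT] f0; have [fu Tfu] := uT f f0.
apply: (@nonpos_on_le _ _ _ _ (rjoin (trunc f - u) 0)); last first.
  by apply: nonpos_on_join => //; exact: nonpos_on_le0.
have -> : rjoin (trunc f - u) 0 = trunc f - rmeet (trunc f) u.
  by rewrite rmeetN opprK [RHS]addrC rjoinD addNr rjoinC addrC.
apply: riesz_leD => //; rewrite riesz_leN2.
by apply: rmeet_mono => //; exact: (trunc_bounds _ _ f0 f0).2.
Qed.

End LocalUnit.

(** * Generic points *)

Section Values.
Context (R : realType) (V : truncRieszType R) (u : V).
Implicit Types (g h x y : V) (b : nat -> V) (D : set V).

Definition refining b := [/\ forall n, 0 <= b n, forall n, b n <> 0,
  forall n, b n <= u & forall n, b n.+1 <= b n].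

Definition dense D := forall x : V, 0 <= x -> x <> 0 -> x <= u ->
  exists y, [/\ 0 <= y, y <> 0, y <= x & D y].

Definition meets b D := exists n, D (b n).

(* The value of [g] at the point defined by [b] is [r]; [u] is the constant
   function [1] on the support of the sequence. *)
Definition has_val b g (r : R) := forall e : R, 0 < e -> exists n,
  nonpos_on (b n) (g - (r + e) *: u) /\ nonpos_on (b n) ((r - e) *: u - g).

(** Stage [k + 1] picks a nonzero element of [D k] below stage [k]; the witness [0] outside [ok]
    only makes [F] total. *)
Lemma refining_exists (D : nat -> set V) : 0 <= u -> u <> 0 ->
  (forall k, dense (D k)) ->
  exists b, refining b /\ forall k, meets b (D k).
Proof.
move=> u0 uN0 dD.
pose ok x := [/\ 0 <= x, x <> 0 & x <= u].
have /choice[F FP] : forall kx : nat * V, exists y, ok kx.2 ->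
    [/\ ok y, y <= kx.2 & D kx.1 y].
  move=> [k x]; have [[x0 xN0 xu]|nx] := pselect (ok x); last by exists 0.
  have [y [y0 yN0 yx Dy]] := dD k x x0 xN0 xu; exists y => _; split => //.
  by split => //; exact: le_trans xu.
pose b := fix b n := if n is m.+1 then F (m, b m) else u.
have okb n : ok (b n).
  by elim: n => [|n IHn]; [split|have [] := FP (n, b n) IHn].
exists b; split.
  split => n; try by have [] := okb n.
  by have [] := FP (n, b n) (okb n).
by move=> k; exists k.+1; have [] := FP (k, b k) (okb k).
Qed.

(** If every [a m] is at most [q *: u] on [x], distributivity passes this to [s]; otherwise [x]
    shrinks to the piece where some [a m] exceeds [q *: u]. *)
Lemma dense_sup (a : nat -> V) s (q : R) : supremums (range a) s ->
  dense [set y | nonpos_on y (s - q *: u) \/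
    exists m, nonpos_on y (q *: u - a m)].
Proof.
move=> sa x x0 xN0 xu.
have [xs|xs] := pselect (nonpos_on x (s - q *: u)).
  by exists x; split => //; left.
have [m xm] : exists m, ~ nonpos_on x (a m - q *: u).
  apply: contra_notP xs => /forallNP xs.
  apply: (rmeet_sup (supremumsD (- (q *: u)) sa)) => _ [_ [m _ <-] <-].
  exact: contrapT (xs m).
exists (rmeet (rjoin (a m - q *: u) 0) x).
have [y0 yN0 yx] := nonpos_on_pos_neq0 x0 xm; split => //.
by right; exists m; rewrite -[X in nonpos_on _ X]opprB; exact: nonpos_on_pos.
Qed.

(** Otherwise [g] is at least [n%:R *: u] on [x] for every [n], so all multiples of [x] lie below
    the positive part of [g], against the Archimedean property. *)
Lemma dense_bounded g : sigma_complete V -> 0 <= u ->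
  dense [set y | exists n : nat, nonpos_on y (g - n%:R *: u)].
Proof.
move=> sV u0 x x0 xN0 xu; apply: contrapT => nx; apply: xN0.
apply: (@sigma_complete_archi _ _ _ (rjoin g 0)) => // n.
have xn : nonpos_on x (n%:R *: u - g).
  apply: contrapT => xn; apply: nx; exists (rmeet (rjoin (n%:R *: u - g) 0) x).
  have [y0 yN0 yx] := nonpos_on_pos_neq0 x0 xn; split => //.
  by exists n; rewrite -[X in nonpos_on _ X]opprB; exact: nonpos_on_pos.
have {}xn : nonpos_on x (x *+ n - rjoin g 0).
  apply: nonpos_on_le xn; apply: riesz_leD; last first.
    by rewrite riesz_leN2 rjoin_gel.
  by rewrite -scaler_nat; apply: riesz_scale_ler.
rewrite -riesz_subr_le0; set d := _ - _.
suff <- : rjoin d 0 = 0 by exact: rjoin_gel.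
apply: (@nonpos_on_mulrn_le _ _ _ x n).
- exact: rjoin_ger.
- apply: rjoin_lub; last exact: riesz_mulrn_ge0.
  rewrite riesz_leBlDr -[leLHS]addr0; apply: riesz_leD => //.
  exact: rjoin_ger.
- rewrite /nonpos_on rmeetC; apply: nonpos_on_join => //.
  exact: nonpos_on_le0.
Qed.

(** * Calculus of values along a fixed refining sequence *)

Section FixedPoint.
Context (b : nat -> V) (u1 : local_unit u) (refb : refining b).
Implicit Types (r s : R).

Let u0 : 0 <= u. Proof. by case: u1. Qed.
Let b0 n : 0 <= b n. Proof. by case: refb. Qed.

Lemma refining_le m n : (m <= n)%N -> b n <= b m.
Proof.
move=> /subnK <-; elim: (n - m)%N => // k IHk; rewrite addSn.
by case: refb => _ _ _ bS; exact: le_trans (bS _) IHk.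
Qed.

Lemma nonpos_on_later m n x : (m <= n)%N -> nonpos_on (b m) x ->
  nonpos_on (b n) x.
Proof. by move=> /refining_le; exact: nonpos_on_sub. Qed.

(** At a common later stage the two conditions add up to [(q' - q) *: u <= 0] there; as that stage
    is nonzero and below [u], [q < q'] is impossible. *)
Lemma nonpos_on_scale_le m n (g : V) (q q' : R) :
  nonpos_on (b m) (g - q *: u) -> nonpos_on (b n) (q' *: u - g) -> q' <= q.
Proof.
move=> /(nonpos_on_later (leq_maxl m n)) gq.
move=> /(nonpos_on_later (leq_maxr m n)) gq'.
rewrite leNgt; apply/negP => qq'; have [_ bN0 bu _] := refb.
apply: (bN0 (maxn m n)); apply: (@nonpos_on_self _ _ (q' - q)) => //.
  by rewrite subr_gt0.
have := nonpos_onD (b0 _) gq gq'; rewrite addrC addrA subrK -scalerBl.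
by apply: nonpos_on_le; apply: riesz_scale_ler => //; rewrite subr_ge0 ltW.
Qed.

Lemma has_val_le g h r s : g <= h -> has_val b g r -> has_val b h s -> r <= s.
Proof.
move=> gh gr hs; apply/ler_addgt0Pr => e e0.
have e2 : 0 < e / 2 by rewrite divr_gt0.
have [m [_ gm]] := gr _ e2; have [n [hn _]] := hs _ e2.
have {}hn : nonpos_on (b n) (g - (s + e / 2) *: u).
  by apply: nonpos_on_le hn; rewrite riesz_leD2r.
by have := nonpos_on_scale_le hn gm; rewrite lerBlDr -addrA -splitr.
Qed.

Lemma has_val_near g r : (forall e, 0 < e ->
    (exists n, nonpos_on (b n) (g - (r + e) *: u)) /\
    (exists n, nonpos_on (b n) ((r - e) *: u - g))) -> has_val b g r.
Proof.
move=> gr e e0; have [[m gm] [n gn]] := gr e e0; exists (maxn m n).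
split; first exact: nonpos_on_later (leq_maxl m n) gm.
exact: nonpos_on_later (leq_maxr m n) gn.
Qed.

Lemma has_valD g h r s : has_val b g r -> has_val b h s ->
  has_val b (g + h) (r + s).
Proof.
move=> gr hs; apply: has_val_near => e e0.
have e2 : 0 < e / 2 by rewrite divr_gt0.
have [m [gm gm']] := gr _ e2; have [n [hn hn']] := hs _ e2.
split; exists (maxn m n).
  have := nonpos_onD (b0 _) (nonpos_on_later (leq_maxl m n) gm)
    (nonpos_on_later (leq_maxr m n) hn).
  by rewrite addrACA -opprD -scalerDl [in X in _ -> X](splitr e) addrACA.
have := nonpos_onD (b0 _) (nonpos_on_later (leq_maxl m n) gm')
  (nonpos_on_later (leq_maxr m n) hn').
have -> : r + s - e = (r - e / 2) + (s - e / 2).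
  by rewrite {1}(splitr e) opprD addrACA.
by rewrite addrACA -opprD -scalerDl.
Qed.

Lemma has_val0 : has_val b 0 0.
Proof.
move=> e e0; exists 0%N; split; apply: nonpos_on_le0.
  by rewrite sub0r add0r riesz_oppr_le0 rieszZ_ge0// ltW.
by rewrite sub0r subr0 scaleNr riesz_oppr_le0 rieszZ_ge0// ltW.
Qed.

Lemma has_val_unit : has_val b u 1.
Proof.
move=> e e0; exists 0%N; split; apply: nonpos_on_le0.
  rewrite -{1}[u]scale1r -scalerBl opprD addNKr scaleNr riesz_oppr_le0.
  by rewrite rieszZ_ge0// ltW.
rewrite -{2}[u]scale1r -scalerBl addrAC subrr sub0r scaleNr riesz_oppr_le0.
by rewrite rieszZ_ge0// ltW.
Qed.

Lemma has_valN g r : has_val b g r -> has_val b (- g) (- r).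
Proof.
move=> gr e e0; have [n [gn gn']] := gr e e0; exists n; split.
  by move: gn'; rewrite -scaleNr opprD opprK addrC.
by rewrite -opprD scaleNr opprK addrC.
Qed.

Lemma has_valZ a g r : has_val b g r -> has_val b (a *: g) (a * r).
Proof.
have pos a' : 0 < a' -> has_val b g r -> has_val b (a' *: g) (a' * r).
  move=> a0 gr e e0; have [n [gn gn']] := gr (e / a') (divr_gt0 e0 a0).
  exists n; split.
    have := nonpos_onZ (ltW a0) (b0 _) gn.
    by rewrite scalerBr scalerA mulrDr mulrCA mulfV ?gt_eqF// mulr1.
  have := nonpos_onZ (ltW a0) (b0 _) gn'.
  by rewrite scalerBr scalerA mulrBr mulrCA mulfV ?gt_eqF// mulr1.
move=> gr; case: (ltgtP a 0) => [a0|a0|->]; last first.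
- by rewrite scale0r mul0r; exact: has_val0.
- exact: pos.
rewrite -[a]opprK mulNr scaleNr; apply: has_valN; apply: pos => //.
by rewrite oppr_gt0.
Qed.

Lemma has_val_join g h r s : has_val b g r -> has_val b h s ->
  has_val b (rjoin g h) (Num.max r s).
Proof.
move=> gr hs; apply: has_val_near => e e0.
have [m [gm gm']] := gr _ e0; have [n [hn hn']] := hs _ e0; split.
  exists (maxn m n); rewrite rjoinD; apply: nonpos_on_join.
    apply: nonpos_on_le (nonpos_on_later (leq_maxl m n) gm).
    by rewrite riesz_leD// riesz_leN2 riesz_scale_lel// lerD2r le_max lexx.
  apply: nonpos_on_le (nonpos_on_later (leq_maxr m n) hn).
  by rewrite riesz_leD// riesz_leN2 riesz_scale_lel// lerD2r le_max lexx orbT.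
have [sr|rs] := leP s r; [exists m|exists n].
  by apply: nonpos_on_le gm'; rewrite riesz_leD// riesz_leN2 rjoin_gel.
by apply: nonpos_on_le hn'; rewrite riesz_leD// riesz_leN2 rjoin_ger.
Qed.

Lemma has_val_meet g h r s : has_val b g r -> has_val b h s ->
  has_val b (rmeet g h) (Num.min r s).
Proof.
move=> gr hs; rewrite rmeetN.
have -> : Num.min r s = - Num.max (- r) (- s) by rewrite oppr_max !opprK.
by apply: has_valN; apply: has_val_join; exact: has_valN.
Qed.

(** For [f >= 0], [trunc f] and [rmeet f u] agree on the support of [u], so their difference has
    value [0]; (T1) reduces [g] to its positive and negative parts. *)
Lemma has_val_trunc g r : has_val b g r -> has_val b (trunc g) (Num.min r 1).
Proof.
have pos f s : 0 <= f -> has_val b f s -> has_val b (trunc f) (Num.min s 1).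
  move=> f0 fs; have fus := has_val_meet fs has_val_unit.
  rewrite -[trunc f](subrK (rmeet f u)) -[Num.min s 1]add0r.
  apply: has_valD => // e e0; exists 0%N; split.
    apply: (@nonpos_on_le _ _ _ _ (trunc f - rmeet f u)).
      rewrite riesz_leBlDr -[leLHS]addr0 riesz_leD// add0r rieszZ_ge0// ltW//.
    apply: nonpos_on_sub (local_unit_trunc u1 f0).
    by case: refb.
  apply: nonpos_on_le0; rewrite sub0r scaleNr -opprD riesz_oppr_le0.
  rewrite -[0]addr0 riesz_leD//; first by rewrite rieszZ_ge0// ltW.
  by rewrite riesz_subr_ge0; case: (u1.2 f f0).
move=> gr; rewrite trunc_pos_neg /rneg opprK.
have -> : Num.min r 1 = Num.min (Num.max r 0) 1 + Num.min r 0.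
  have [r0|r0] := leP r 0; have [r1|r1] := leP r 1.
  - by rewrite (min_idPl ler01) add0r.
  - by have := lt_le_trans r1 r0; rewrite ltNge ler01.
  - by rewrite addr0.
  - by rewrite addr0.
apply: has_valD; last by apply: has_val_meet => //; exact: has_val0.
apply: pos; first exact: rjoin_ger.
by apply: has_val_join => //; exact: has_val0.
Qed.

(** A Dedekind cut: the value is [sup S]. The two boundedness requirements make [S] nonempty and
    bounded; at a rational just above [sup S], the decision can only be [g <= ratr q *: u]. *)
Lemma has_val_exists g :
  (forall q : rat, meets b [set y | nonpos_on y (g - ratr q *: u) \/
     nonpos_on y (ratr q *: u - g)]) ->
  meets b [set y | exists n : nat, nonpos_on y (g - n%:R *: u)] ->
  meets b [set y | exists n : nat, nonpos_on y (- g - n%:R *: u)] ->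
  exists r, has_val b g r.
Proof.
move=> gq [m [M gM]] [n [N gN]].
pose S := [set q : R | exists n, nonpos_on (b n) (q *: u - g)].
have SN : S (- N%:R) by exists n; rewrite scaleNr addrC.
have ubS : ubound S M%:R by move=> q [k gk]; exact: nonpos_on_scale_le gM gk.
have supS : has_sup S by split; [exists (- N%:R)|exists M%:R].
exists (sup S); apply: has_val_near => e e0; split.
  have [q] := rat_in_itvoo (ltr_pwDr e0 (lexx (sup S))).
  rewrite in_itv/= => /andP[Sq qe].
  have [k [gk|gk]] := gq q; exists k.
    apply: nonpos_on_le gk; rewrite riesz_leD// riesz_leN2 riesz_scale_lel//.
    exact: ltW.
  have : ratr q <= sup S by apply: ub_le_sup; [exists M%:R|exists k].
  by rewrite leNgt Sq.
have [q [k gk] qe] := sup_adherent e0 supS; exists k.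
by apply: nonpos_on_le gk; rewrite riesz_leD// riesz_scale_lel// ltW.
Qed.

(** At a rational [q] just above [sup (range v)], the alternative [ratr q *: u <= a m] would force
    [ratr q <= v m]; so [g] is bounded above by [ratr q *: u]. The lower bound comes from an [a m]
    whose value is near the supremum. *)
Lemma has_val_sup (a : nat -> V) g (v : nat -> R) c :
  supremums (range a) g -> (forall n, has_val b (a n) (v n)) ->
  (forall n, v n <= c) ->
  (forall q : rat, meets b [set y | nonpos_on y (g - ratr q *: u) \/
    exists m, nonpos_on y (ratr q *: u - a m)]) ->
  has_val b g (sup (range v)).
Proof.
move=> [ag ga] av vc gq; apply: has_val_near => e e0.
have supv : has_sup (range v).
  by split; [exists (v 0%N), 0%N|exists c => _ [n _ <-]].
split.
  have [q] := rat_in_itvoo (ltr_pwDr e0 (lexx (sup (range v)))).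
  rewrite in_itv/= => /andP[vq qe].
  have [k [gk|[m gk]]] := gq q; exists k.
    apply: nonpos_on_le gk; rewrite riesz_leD// riesz_leN2 riesz_scale_lel//.
    exact: ltW.
  suff : ratr q <= sup (range v) by rewrite leNgt vq.
  apply: le_trans (_ : ratr q <= v m) _; last first.
    by apply: sup_ubound; [exact: supv.2|exists m].
  apply/ler_addgt0Pr => d d0; have [l [al _]] := av m _ d0.
  exact: nonpos_on_scale_le al gk.
have e2 : 0 < e / 2 by rewrite divr_gt0.
have [_ [m _ <-] vm] := sup_adherent e2 supv.
have [n [_ an]] := av m _ e2; exists n; apply: nonpos_on_le an.
rewrite riesz_leD//; last by rewrite riesz_leN2; apply: ag; exists m.
rewrite riesz_scale_lel//; rewrite ltrBlDr in vm; rewrite lerBlDr.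
by rewrite [X in _ + X]splitr addrA subrK ltW.
Qed.

End FixedPoint.

End Values.

(** * Terms and their values *)

Lemma countable_range (T : Type) (A : set T) : A !=set0 -> countable A ->
  exists f : nat -> T, range f = A.
Proof.
move=> A0 /pfcard_geP[AE|/unsquash f]; first by move: A0; rewrite AE => -[].
by exists f; exact: surj_image_eq.
Qed.

Lemma countable_setU (T : Type) (A B : set T) : countable A -> countable B ->
  countable (A `|` B).
Proof.
move=> cA cB; rewrite -bigcup2E; apply: bigcup_countable => // -[|[|n]] _ //=.
Qed.

Lemma countable_image (T U : Type) (f : T -> U) (A : set T) :
  countable A -> countable (f @` A).
Proof. exact: sub_countable (card_image_le f A). Qed.

Inductive term (R : realType) (I : Type) : Type :=
| TZero
| TVar of I
| TAdd of term R I & term R I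
| TScale of R & term R I
| TJoin of term R I & term R I
| TTrunc of term R I
| TSup of (nat -> term R I) & term R I.

(* [TSup a c] stands for the supremum over [n] of the meets of [a n] and [c],
   which makes sense in every Dedekind sigma-complete space. *)
Fixpoint eval (R : realType) (I : Type) (G : truncRieszType R) (h : I -> G)
    (t : term R I) : G :=
  match t with
  | TZero => 0
  | TVar i => h i
  | TAdd s t => eval h s + eval h t
  | TScale a t => a *: eval h t
  | TJoin s t => rjoin (eval h s) (eval h t)
  | TTrunc t => trunc (eval h t)
  | TSup a c =>
    xget 0 (supremums (range (fun n => rmeet (eval h (a n)) (eval h c))))
  end.

(** The meets are bounded by the value of [c], so the default [0] in [eval] is never taken. *)
Lemma eval_sup (R : realType) (I : Type) (G : truncRieszType R) (h : I -> G)
    (a : nat -> term R I) (c : term R I) : sigma_complete G ->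
  supremums (range (fun n => rmeet (eval h (a n)) (eval h c)))
    (eval h (TSup a c)).
Proof.
move=> sG; apply: xgetPex.
by apply: (@sigma_complete_seq _ _ _ (eval h c)) => // n; exact: rmeet_ler.
Qed.

(** * Countable suprema in [Ft R I] are pointwise *)

Section FtSup.
Context (R : realType) (I : Type).
Implicit Types (f g : Ft R I).

Lemma Ft_scaleE (a : R) f x : (a *: f) x = a * f x.
Proof. by []. Qed.

(** The pointwise supremum lies between [F 0] and [g], so its absolute value is at most the sum of
    theirs. *)
Lemma Ft_sup_seq (F : nat -> Ft R I) g : (forall n, F n <= g) ->
  exists s : Ft R I, supremums (range F) s /\
    forall x, s x = sup (range (fun n => F n x)).
Proof.
move=> Fg; have Fgx n x : F n x <= g x.
  by have := Fg n; rewrite Ft_le => /asboolP.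
have ubF x : has_ubound (range (fun n => F n x)) by exists (g x) => _ [n _ <-].
have supF x n : F n x <= sup (range (fun n => F n x)).
  by apply: ub_le_sup => //; exists n.
have supg x z : (forall n, F n x <= z) -> sup (range (fun n => F n x)) <= z.
  move=> Fz; apply: ge_sup; first by exists (F 0%N x), 0%N.
  by move=> _ [n _ <-].
have sP : (fun x => sup (range (fun n => F n x))) \in Ft_pred R I.
  apply: (Ft_le_normD (valP (F 0%N)) (valP g)) => [|x].
    rewrite (_ : (fun x => _) = (fun x => sups (fun n => F n x) 0%N)).
      apply: measurable_fun_sups => // n; have := valP (F n).
      by rewrite inE => -[].
    by apply/funext => x; rewrite /sups /sdrop; congr (sup _);
      apply/seteqP; split => _ [n _ <-]; exists n.
  have := supF x 0%N; have := supg x (g x) (Fgx ^~ x).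
  set s := sup _ => sg Fs; rewrite ler_norml; apply/andP; split.
    rewrite lerNl (le_trans (_ : - s <= `|F 0%N x|))// ?lerDl//.
    by rewrite (le_trans (_ : - s <= - F 0%N x))// ?lerN2// -normrN ler_norm.
  by rewrite (le_trans sg)// (le_trans (ler_norm _))// lerDr.
exists (MkFt sP); split => //; split => [_ [n _ <-]|z zF].
  by rewrite Ft_le; apply/asboolP => x; exact: supF.
rewrite Ft_le; apply/asboolP => x; apply: supg => n.
by have := zF (F n) (imageT _ _); rewrite Ft_le => /asboolP.
Qed.

Lemma Ft_supE (F : nat -> Ft R I) s x : supremums (range F) s ->
  s x = sup (range (fun n => F n x)).
Proof.
move=> Fs; have [|s' [Fs' s'E]] := @Ft_sup_seq F s.
  by move=> n; apply: Fs.1; exists n.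
by rewrite (is_subset1_supremums Fs Fs') s'E.
Qed.

Lemma Ft_sigma_complete : sigma_complete (Ft R I).
Proof.
move=> A A0 /(countable_range A0)[F <-] [g Fg].
have [|s [Fs _]] := @Ft_sup_seq F g; last by exists s.
by move=> n; apply: Fg; exists n.
Qed.

End FtSup.

(** * Transfer of inequalities between terms from [Ft R I] to [G] *)

Section Evaluation.
Context (R : realType) (I : Type) (G : truncRieszType R) (h : I -> G).
Hypothesis sG : sigma_complete G.

Local Notation evalF := (eval (@Ft_proj R I)).

Section Point.
Context (u : G) (u1 : local_unit u).

(** The default [0] serves the coordinates left undecided by [b]; those of the variables of the term
    at hand get their value. *)
Definition point_of (b : nat -> G) (i : I) : R := xget 0 (has_val u b (h i)).

Lemma dense_decide (g : G) (q : R) :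
  dense u [set y | nonpos_on y (g - q *: u) \/ nonpos_on y (q *: u - g)].
Proof.
have gs : supremums (range (fun _ : nat => g)) g.
  by split=> [_ [n _ <-]//|z]; apply; exists 0%N.
move=> x x0 xN0 xu.
have [y [y0 yN0 yx [gy|[_ gy]]]] := dense_sup q gs x0 xN0 xu.
  by exists y; split => //; left.
by exists y; split => //; right.
Qed.

(** Requirements arise only at variables (rational decisions and bounds) and at suprema (the
    alternatives of [dense_sup]); a term has countably many subterms, so countably many suffice. *)
Lemma eval_has_val (t : term R I) : exists S : set (set G),
  [/\ countable S, forall D, S D -> dense u D
    & forall b, refining u b -> (forall D, S D -> meets b D) ->
      has_val u b (eval h t) (evalF t (point_of b))].
Proof.
have u0 := u1.1.
elim: t => [|i|s [S [cS dS Sv]] t [T [cT dT Tv]]|a t [T [cT dT Tv]]|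
    s [S [cS dS Sv]] t [T [cT dT Tv]]|t [T [cT dT Tv]]|a IHa c [T [cT dT Tv]]].
- by exists set0; split => // b bP _; exact: has_val0.
- pose Dec (q : rat) := [set y | nonpos_on y (h i - ratr q *: u) \/
    nonpos_on y (ratr q *: u - h i)].
  pose Bnd (g : G) := [set y | exists n : nat, nonpos_on y (g - n%:R *: u)].
  exists (range Dec `|` [set Bnd (h i); Bnd (- h i)]); split.
  + apply: countable_setU; first exact: countable_image.
    by apply: countable_setU.
  + move=> D [[q _ <-]|[->|->]]; first exact: dense_decide.
      exact: dense_bounded.
    exact: dense_bounded.
  + move=> b bP Db; apply: (@xgetPex _ 0); apply: has_val_exists => //.
    * by move=> q; apply: Db; left; exists q.
    * by apply: Db; right; left.
    * by apply: Db; right; right.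
- exists (S `|` T); split; first exact: countable_setU.
    by move=> D [/dS|/dT].
  move=> b bP Db; apply: has_valD => //.
    by apply: Sv => // D SD; apply: Db; left.
  by apply: Tv => // D TD; apply: Db; right.
- exists T; split; [exact: cT|exact: dT|move=> b bP Db].
  rewrite [evalF _]/= Ft_scaleE.
  exact: has_valZ u1 bP a _ _ (Tv b bP Db).
- exists (S `|` T); split; first exact: countable_setU.
    by move=> D [/dS|/dT].
  move=> b bP Db; apply: has_val_join => //.
    by apply: Sv => // D SD; apply: Db; left.
  by apply: Tv => // D TD; apply: Db; right.
- by exists T; split => // b bP Db; apply: has_val_trunc => //; exact: Tv.
- move: IHa => /choice[S SP].
  have sup_ac := eval_sup h a c sG.
  pose Dec (q : rat) := [set y |
    nonpos_on y (eval h (TSup a c) - ratr q *: u) \/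
    exists m, nonpos_on y (ratr q *: u - rmeet (eval h (a m)) (eval h c))].
  exists (\bigcup_n S n `|` T `|` range Dec); split.
  + apply: countable_setU; last exact: countable_image.
    apply: countable_setU => //; apply: bigcup_countable => // n _.
    by have [] := SP n.
  + move=> D [[[n _]|/dT//]|[q _ <-]]; last exact: dense_sup.
    by have [_ + _] := SP n; apply.
  + move=> b bP Db.
    have cv : has_val u b (eval h c) (evalF c (point_of b)).
      by apply: Tv => // D TD; apply: Db; left; right.
    have av n : has_val u b (eval h (a n)) (evalF (a n) (point_of b)).
      have [_ _] := SP n; apply => // D SD.
      by apply: Db; left; left; exists n.
    rewrite (Ft_supE _ (eval_sup _ a c (@Ft_sigma_complete R I))).
    apply: (has_val_sup u1 bP sup_ac (c := evalF c (point_of b))).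
    * by move=> n; apply: has_val_meet.
    * by move=> n; rewrite /= ge_min lexx orbT.
    * by move=> q; apply: Db; right; exists q.
Qed.

End Point.

(** If [g] were nonzero, a local unit [u] would lie below [g *+ n]; at a generic point [g *+ n] has
    value [0], since [t] is [<= 0] there, while [u] has value [1]. *)
Lemma eval_le0 (t : term R I) : evalF t <= 0 -> eval h t <= 0.
Proof.
rewrite Ft_le => /asboolP t0; set g := rjoin (eval h t) 0.
suff g0 : g = 0 by rewrite -g0; exact: rjoin_gel.
apply: contrapT => gN0.
have [u [n [u1 uN0 ug]]] := local_unit_exists sG (rjoin_ger _ _) gN0.
have [S [cS dS Sv]] := eval_has_val u1 t.
(* Adding [setT], which is trivially dense, makes the family nonempty, so that a sequence enumerates
   it. *)
have cS' : countable (S `|` [set setT]).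
  exact: countable_setU.
have [|D DE] := countable_range _ cS'; first by exists setT; right.
have [k|b [bP Db]] := refining_exists (D := D) u1.1 uN0.
  have : range D (D k) by exists k.
  rewrite DE => -[/dS//|->] x x0 xN0 xu; by exists x.
have tv : has_val u b (eval h t) (evalF t (point_of u b)).
  apply: Sv => // E SE; have : range D E by rewrite DE; left.
  by move=> [k _ <-].
have gv : has_val u b (g *+ n) 0.
  rewrite -scaler_nat -(mulr0 n%:R); apply: has_valZ => //.
  have t0' : evalF t (point_of u b) <= 0 := t0 (point_of u b).
  rewrite -(max_idPr t0'); apply: has_val_join => //.
  exact: has_val0.
by have := has_val_le bP ug (has_val_unit b u1) gv; rewrite leNgt ltr01.
Qed.

Lemma eval_le (s t : term R I) : evalF s <= evalF t -> eval h s <= eval h t.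
Proof.
rewrite -riesz_subr_le0 -[eval h s <= _]riesz_subr_le0 => st.
have := @eval_le0 (TAdd s (TScale (-1) t)).
by rewrite /= !scaleN1r; apply.
Qed.

Lemma eval_eq (s t : term R I) : evalF s = evalF t -> eval h s = eval h t.
Proof. by move=> st; apply/eqP; rewrite eq_le !eval_le// st. Qed.

End Evaluation.

(** * Generation by the projections *)

Section Generation.
Context (R : realType) (I : Type).
Implicit Types (f g e y : (I -> R) -> R) (B : set (I -> R)).

Local Notation evalF := (eval (@Ft_proj R I)).

Definition generated f := exists t : term R I, evalF t = f :> ((I -> R) -> R).

Lemma generatedD f g : generated f -> generated g ->
  generated (fun x => f x + g x).
Proof. by move=> [s <-] [t <-]; exists (TAdd s t). Qed.

Lemma generatedZ (a : R) f : generated f -> generated (fun x => a * f x).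
Proof.
move=> [t <-]; exists (TScale a t); apply/funext => x.
exact: Ft_scaleE.
Qed.

Lemma generatedB f g : generated f -> generated g ->
  generated (fun x => f x - g x).
Proof.
move=> gf /(generatedZ (-1))/(generatedD gf).
by congr generated; apply/funext => x; rewrite mulN1r.
Qed.

Lemma generated_max f g : generated f -> generated g ->
  generated (fun x => Num.max (f x) (g x)).
Proof. by move=> [s <-] [t <-]; exists (TJoin s t). Qed.

Lemma generated_trunc f : generated f -> generated (fun x => Num.min (f x) 1).
Proof. by move=> [t <-]; exists (TTrunc t). Qed.

Lemma generated_proj i : generated (fun x => x i).
Proof. by exists (TVar R i). Qed.

Lemma generated_min f g : generated f -> generated g ->
  generated (fun x => Num.min (f x) (g x)).
Proof.
move=> gf gg; have := generatedB (generatedD gf gg) (generated_max gf gg).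
congr generated; apply/funext => x.
by rewrite -[f x + g x]addr_max_min addrC addKr.
Qed.

Lemma generated_sup (F : nat -> (I -> R) -> R) c f :
  (forall n, generated (F n)) -> generated c -> (forall n x, F n x <= c x) ->
  (forall n x, F n x <= f x) ->
  (forall x z, (forall n, F n x <= z) -> f x <= z) -> generated f.
Proof.
move=> /choice[t tF] [s sc] Fc Ff fF; exists (TSup t s); apply/funext => x.
rewrite (Ft_supE _ (eval_sup _ t s (@Ft_sigma_complete R I))).
rewrite (_ : (fun n => _) = (fun n => F n x)); last first.
  apply/funext => n; change (Num.min (evalF (t n) x) (evalF s x) = F n x).
  by rewrite tF sc; apply/min_idPl.
apply/eqP; rewrite eq_le; apply/andP; split.
  by apply: ge_sup; [exists (F 0%N x), 0%N|move=> _ [n _ <-]].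
apply: fF => n; apply: ub_le_sup; last by exists n.
by exists (f x) => _ [k _ <-].
Qed.

Definition restrict_to e B : (I -> R) -> R :=
  fun x => if `[< B x >] then e x else 0.

(** Indicators are taken relative to some [e], because the constant [1] is not in [Ft R I]: the
    bounds defining it vanish at the origin. *)
Definition generated_set B := forall e, generated e -> (forall x, 0 <= e x) ->
  generated (restrict_to e B).

(** Rescaled truncation gives [m = y^+ - t * min (y^+ / t) 1], the subtracted term vanishing for
    [t = 0]; then [e] restricted to [{m > 0}] is the supremum of the [min e (n * m)]. *)
Lemma generated_set_gt y (t : R) : generated y -> 0 <= t ->
  generated_set [set x | t < y x].
Proof.
move=> gy t0 e ge e0.
have g0 : generated (fun=> 0).
  by have := generatedZ 0 ge; congr generated; apply/funext => x; rewrite mul0r.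
pose m x := Num.max (y x - t) 0.
have gm : generated m.
  have gy0 := generated_max gy g0.
  have := generatedB gy0 (generatedZ t (generated_trunc (generatedZ t^-1 gy0))).
  congr generated; apply/funext => x; rewrite /m.
  move: t0; rewrite le_eqVlt => /predU1P[<-|t0]; first by rewrite mul0r !subr0.
  rewrite minr_pMr ?(ltW t0)// mulVKf ?gt_eqF// mulr1.
  have [yt|yt] := leP (y x - t) 0.
    rewrite (min_idPl _) ?subrr// ge_max (ltW t0) andbT.
    by rewrite -subr_le0.
  rewrite subr_gt0 in yt; rewrite (max_idPl _) ?(ltW (lt_trans t0 yt))//.
  by rewrite (min_idPr _) ?(ltW yt).
pose F n x := Num.min (e x) (n%:R * m x).
apply: (generated_sup (F := F) (c := e)) => //; rewrite /F.
- by move=> n; apply: generated_min => //; exact: generatedZ.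
- by move=> n x; rewrite ge_min lexx.
- move=> n x; rewrite /restrict_to; case: asboolP => /= xB.
    by rewrite ge_min lexx.
  rewrite /m (max_idPr _) ?mulr0 ?ge_min ?lexx ?orbT//.
  by rewrite subr_le0 leNgt; apply/negP.
- move=> x z; rewrite /restrict_to; case: asboolP => /= xB zB; last first.
    by have := zB 0%N; rewrite mul0r (min_idPr _).
  have yt : 0 < y x - t by rewrite subr_gt0.
  have := zB (Num.truncn (e x / (y x - t))).+1.
  rewrite (min_idPl _)// /m (max_idPl _) ?(ltW yt)//.
  by rewrite -ler_pdivrMr// ltW// truncnS_gt.
Qed.

Lemma generated_setC B : generated_set B -> generated_set (~` B).
Proof.
move=> gB e ge e0; have := generatedB ge (gB e ge e0); congr generated.
apply/funext => x; rewrite /restrict_to.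
case: asboolP => xB; case: asboolP => //= xB'.
- by rewrite subrr.
- by rewrite subr0.
Qed.

Lemma generated_set_bigcup (B : nat -> set (I -> R)) :
  (forall n, generated_set (B n)) -> generated_set (\bigcup_n B n).
Proof.
move=> gB e ge e0.
apply: (generated_sup (F := fun n => restrict_to e (B n)) (c := e)) => //.
- by move=> n; exact: gB.
- by move=> n x; rewrite /restrict_to; case: ifP.
- move=> n x; rewrite /restrict_to; case: asboolP => xB.
    by rewrite asboolT//; exists n.
  by case: ifP.
- move=> x z; rewrite /restrict_to.
  case: asboolP => [[n _ xB] /(_ n)|_ /(_ 0%N)].
    by rewrite asboolT.
  by apply: le_trans; case: ifP.
Qed.

Lemma generated_set0 : generated_set set0.
Proof.
move=> e ge _; have := generatedZ 0 ge; congr generated; apply/funext => x.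
by rewrite /restrict_to mul0r; case: asboolP.
Qed.

Lemma generated_set_proj i (B : set R) : measurable B ->
  generated_set [set x | B (x i)].
Proof.
have -> : measurable B = <<s @RGenOInfty.G R >> B :=
  congr1 (@^~ B) (RGenOInfty.measurableE R).
move: B; apply: (smallest_sub (X := [set B | generated_set [set x | B (x i)]])).
  split=> [|A gA|F gF]; first exact: generated_set0.
    by rewrite setTD; exact: generated_setC.
  by have := generated_set_bigcup gF; congr generated_set; apply/seteqP.
move=> _ [t ->] /=.
rewrite [X in generated_set X](_ : _ = [set x | t < x i]); last first.
  by apply/seteqP; split=> x /=; rewrite in_itv/= andbT.
have [t0|t0] := leP 0 t; first exact: generated_set_gt (generated_proj i) t0.
(* Only thresholds [>= 0] are available, so for [t < 0] the set is exhausted by the sets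
   [{- x i <= s n}], where [s n >= 0] increases to [- t] without reaching it. *)
pose s n := - t * (1 - n.+1%:R^-1).
have s0 n : 0 <= s n.
  by rewrite mulr_ge0// ?oppr_ge0 ?(ltW t0)// subr_ge0 invf_le1// ler1n.
have sE : [set x : I -> R | t < x i] = \bigcup_n ~` [set x | s n < -1 * x i].
  apply/seteqP; split=> x /=.
    move=> tx; have xt : 0 < - t + x i by rewrite addrC subr_gt0.
    exists (Num.truncn (- t / (- t + x i))) => //=.
    rewrite mulN1r; apply/negP; rewrite -leNgt /s mulrBr mulr1 lerBrDl lerBlDr.
    rewrite ler_pdivrMr// [leRHS]mulrC -ler_pdivrMr//.
    by rewrite ltW// truncnS_gt.
  move=> [n _] /negP; rewrite mulN1r -leNgt lerNl; apply: lt_le_trans.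
  by rewrite /s mulNr opprK -[ltLHS]mulr1 ltr_nM2l// gtrBl invr_gt0.
rewrite sE; apply: generated_set_bigcup => n; apply: generated_setC.
by apply: generated_set_gt => //; apply: generatedZ; exact: generated_proj.
Qed.

Lemma generated_set_Cyl (B : set (Cyl R I)) : measurable B -> generated_set B.
Proof.
apply: (smallest_sub (X := generated_set)).
  split; [exact: generated_set0| |exact: generated_set_bigcup].
  by move=> A; rewrite setTD; exact: generated_setC.
by move=> _ [i _ [A mA <-]]; rewrite setTI; exact: generated_set_proj.
Qed.

Lemma generated_bound (J : seq {classic I}) (lam : {classic I} -> R) :
  generated (fun x => \sum_(j <- J) lam j * `|x j|).
Proof.
elim: J => [|j J IHJ].
  by exists (TZero R I); apply/funext => x; rewrite big_nil.
have gj := generated_proj j.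
have gabs := generated_max gj (generatedZ (-1) gj).
have := generatedD (generatedZ (lam j) gabs) IHJ.
congr generated; apply/funext => x; rewrite big_cons mulN1r.
case: (leP 0 (x j)) => x0.
  by rewrite ger0_norm// (max_idPl _)// (le_trans _ x0)// oppr_le0.
by rewrite ltr0_norm// (max_idPr _)// (le_trans (ltW x0))// oppr_ge0 ltW.
Qed.

Lemma generated_measurable f : generated f ->
  measurable_fun [set: Cyl R I] (f : Cyl R I -> R).
Proof. by move=> [t <-]; have := valP (evalF t); rewrite inE => -[]. Qed.

Lemma generated_between f e :
  measurable_fun [set: Cyl R I] (f : Cyl R I -> R) ->
  generated e -> (forall x, 0 <= f x) -> (forall x, f x <= e x) -> generated f.
Proof.
move=> mf ge f0 fe.
(* Absolute values make [q] enumerate the nonnegative rationals; codes of no rational give [0]. *)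
pose q n : R := `|ratr (odflt 0 (choice.unpickle n : option rat))|.
have e0 x : 0 <= e x := le_trans (f0 x) (fe x).
have q0 n x : 0 <= q n * e x by rewrite mulr_ge0// /q normr_ge0.
pose F n := restrict_to (fun x => q n * e x) [set x | 0 < f x - q n * e x].
have Ff n x : F n x <= f x.
  by rewrite /F /restrict_to; case: asboolP => //=; rewrite subr_gt0 => /ltW.
apply: (generated_sup (F := F) (c := e)) => //.
- move=> n; apply: generated_set_Cyl; [|exact: generatedZ|exact: q0].
  have : measurable_fun [set: Cyl R I] (fun x : Cyl R I => f x - q n * e x).
    apply: measurable_funB => //; apply: measurable_funM => //.
    exact: generated_measurable.
  move=> /(_ measurableT `]0, +oo[%classic (measurable_itv _)).
  rewrite setTI; congr measurable; apply/seteqP; split=> x /=;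
    by rewrite in_itv/= andbT.
- by move=> n x; exact: le_trans (Ff n x) (fe x).
- move=> x z Fz; rewrite leNgt; apply/negP => zf.
  (* An upper bound [z < f x] would leave room for a rational [r] with [z < r * e x < f x], and then
     [F] at the code of [r] exceeds [z]. *)
  have z0 : 0 <= z.
    by apply: le_trans (Fz 0%N); rewrite /F /restrict_to; case: ifP.
  have ex : 0 < e x by exact: le_lt_trans z0 (lt_le_trans zf (fe x)).
  have : z / e x < f x / e x by rewrite ltr_pM2r// invr_gt0.
  move=> /rat_in_itvoo[r]; rewrite in_itv/= => /andP[zr rf].
  have qr : q (choice.pickle r) = ratr r.
    rewrite /q choice.pickleK/= ger0_norm//; apply/ltW; apply: le_lt_trans zr.
    by rewrite divr_ge0.
  have := Fz (choice.pickle r); rewrite /F /restrict_to qr asboolT/=.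
    by rewrite leNgt -ltr_pdivrMr ?zr.
  by rewrite subr_gt0 -ltr_pdivlMr.
Qed.

Lemma eval_surj (f : Ft R I) : exists t : term R I, evalF t = f.
Proof.
have := valP f; rewrite inE => -[mf [J [lam [lam0 flam]]]].
have ge := generated_bound J lam.
have gp : generated (fun x => Num.max (f x) 0).
  apply: generated_between ge _ _ => [|x|x].
  - by apply: measurable_maxr => //; exact: measurable_cst.
  - by rewrite le_max lexx orbT.
  - by rewrite ge_max (le_trans (ler_norm _) (flam x)) (le_trans _ (flam x)).
have gn : generated (fun x => Num.max (- f x) 0).
  apply: generated_between ge _ _ => [|x|x].
  - apply: measurable_maxr; last exact: measurable_cst.
    exact: measurableT_comp.
  - by rewrite le_max lexx orbT.
  - rewrite ge_max (le_trans _ (flam x)) ?(le_trans _ (flam x))//.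
    by rewrite -normrN ler_norm.
have [t tf] := generatedB gp gn; exists t; apply/val_inj => /=.
rewrite tf; apply/funext => x; have [f0|f0] := leP (f x) 0.
  by rewrite (max_idPl _) ?oppr_ge0// sub0r opprK.
by rewrite (max_idPr _) ?subr0// oppr_le0 ltW.
Qed.

End Generation.

(** * The free morphism *)

Section FreeMorphism.
Context (R : realType) (I : Type) (G : truncRieszType R) (h : I -> G).
Hypothesis sG : sigma_complete G.

Local Notation evalF := (eval (@Ft_proj R I)).

Definition Ft_term (f : Ft R I) : term R I := sval (cid (eval_surj f)).

Lemma Ft_termK f : evalF (Ft_term f) = f.
Proof. exact: svalP (cid (eval_surj f)). Qed.

Definition Ft_lift (f : Ft R I) : G := eval h (Ft_term f).

(** By [eval_eq] the chosen term does not matter, so each morphism law is read off a constructor. *)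
Lemma Ft_lift_eval t : Ft_lift (evalF t) = eval h t.
Proof. by apply: eval_eq => //; rewrite Ft_termK. Qed.

Lemma riesz_morphism_Ft_lift : riesz_morphism Ft_lift.
Proof.
have lin : linear Ft_lift.
  move=> a f g.
  have := Ft_lift_eval (TAdd (TScale a (Ft_term f)) (Ft_term g)).
  by rewrite /= !Ft_termK.
have join : {morph Ft_lift : f g / rjoin f g}.
  move=> f g.
  by have := Ft_lift_eval (TJoin (Ft_term f) (Ft_term g)); rewrite /= !Ft_termK.
split => // f g; rewrite !rmeetE -join.
have D x y : Ft_lift (x + y) = Ft_lift x + Ft_lift y.
  by have := lin 1 x y; rewrite !scale1r.
have L0 : Ft_lift 0 = 0 by exact: (Ft_lift_eval (TZero R I)).
have N x : Ft_lift (- x) = - Ft_lift x.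
  by apply/eqP; rewrite -addr_eq0 addrC -D subrr L0.
by rewrite !D N.
Qed.

Lemma trunc_preserving_Ft_lift : trunc_preserving Ft_lift.
Proof.
by move=> f; have := Ft_lift_eval (TTrunc (Ft_term f)); rewrite /= Ft_termK.
Qed.

(** The supremum is the value of a [TSup] term with the supremum itself as bound, so the meets in
    [eval] change nothing on either side. *)
Lemma sigma_continuous_Ft_lift : sigma_continuous Ft_lift.
Proof.
move=> A s A0 /(countable_range A0)[f <-] fs.
pose a n := Ft_term (f n); pose c := Ft_term s.
have fle n : f n <= s by apply: fs.1; exists n.
have acE : (fun n => rmeet (evalF (a n)) (evalF c)) = f.
  by apply/funext => n; rewrite !Ft_termK rmeet_idl.
have sE : evalF (TSup a c) = s.
  have := eval_sup (@Ft_proj R I) a c (@Ft_sigma_complete R I).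
  by rewrite acE => /is_subset1_supremums; apply.
have := eval_sup h a c sG; rewrite -(Ft_lift_eval (TSup a c)) sE.
rewrite (_ : (fun n => _) = Ft_lift \o f) ?image_comp//.
apply/funext => n /=; rewrite rmeet_idl//; apply: eval_le => //.
by rewrite !Ft_termK.
Qed.

Lemma Ft_lift_proj i : Ft_lift (Ft_proj R i) = h i.
Proof. exact: (Ft_lift_eval (TVar R i)). Qed.

Lemma Ft_lift_unique (psi : Ft R I -> G) : riesz_morphism psi ->
  trunc_preserving psi -> sigma_continuous psi ->
  (forall i, psi (Ft_proj R i) = h i) -> Ft_lift = psi.
Proof.
move=> [lin meet join] tr sc psih; apply/funext => f.
rewrite -[in RHS](Ft_termK f) /Ft_lift.
elim: (Ft_term f) => [|i|s IHs t IHt|a t IHt|s IHs t IHt|t IHt|a IHa c IHc] /=.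
- by have := lin (-1) 0 0; rewrite scaler0 addr0 scaleN1r addNr.
- by rewrite psih.
- by have := lin 1 (evalF s) (evalF t); rewrite !scale1r IHs IHt.
- have p0 : psi 0 = 0.
    by have := lin (-1) 0 0; rewrite scaler0 addr0 scaleN1r addNr.
  by have := lin a (evalF t) 0; rewrite p0 !addr0 IHt.
- by rewrite join IHs IHt.
- by rewrite tr IHt.
- have aN0 : range (fun n => rmeet (evalF (a n)) (evalF c)) !=set0.
    by exists (rmeet (evalF (a 0%N)) (evalF c)), 0%N.
  have := sc _ _ aN0 (countable_image _ _)
    (eval_sup (@Ft_proj R I) a c (@Ft_sigma_complete R I)).
  move=> /(_ (countableP _)).
  have := eval_sup h a c sG.
  rewrite image_comp.
  rewrite (_ : psi \o _ = fun n => rmeet (eval h (a n)) (eval h c)).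
    exact: is_subset1_supremums.
  by apply/funext => n /=; rewrite meet IHa IHc.
Qed.

End FreeMorphism.

(** * Preservation of integrability *)

Section Integrability.
Context (R : realType) (I : Type).

Lemma Lfun_integral_lty d (T : measurableType d)
    (mu : {measure set T -> \bar R}) (p : R) (f : T -> R) : 1 <= p ->
  f \in Lfun mu p%:E <-> measurable_fun [set: T] f /\
    (\int[mu]_x (`|f x| `^ p)%:E < +oo)%E.
Proof.
move=> p1; split=> [fL|[mf foo]].
  have /integrableP[_] := Lfun_integrable p1 fL.
  under eq_integral => x _ do rewrite gee0_abs ?lee_fin ?powR_ge0//.
  by split => //; move: fL; rewrite inE => /andP[/[!inE]].
rewrite inE; apply/andP; split; first by rewrite inE.
by rewrite inE/= /finite_norm unlock poweR_lty.
Qed.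

Lemma measurable_Cyl d (T : measurableType d) (f : I -> T -> R) :
  (forall i, measurable_fun [set: T] (f i)) ->
  measurable_fun [set: T] (fun x => (fun i => f i x) : Cyl R I).
Proof.
move=> mf; apply: (@measurability _ _ T (Cyl R I) _ _ (cylinders R I) erefl).
move=> _ [_ [i _ [A mA <-]] <-]; rewrite !setTI.
by have := mf i measurableT A mA; rewrite setTI.
Qed.

Lemma Ft_preserves_p_integrability (p : R) (tau : (I -> R) -> R) : 1 <= p ->
  Ft_set R I tau -> preserves_p_integrability p tau.
Proof.
move=> p1 [mtau [J [lam [lam0 tauJ]]]] d T mu f fL.
have p0 : 0 <= p by exact: le_trans p1.
have mf i : measurable_fun [set: T] (f i).
  by have /(Lfun_integral_lty _ _ p1)[] := fL i.
have mS : measurable_fun [set: T] (fun x => tau (fun i => f i x)).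
  exact: (measurableT_comp mtau (measurable_Cyl mf)).
pose S (s : seq {classic I}) x := \sum_(j <- s) lam j * `|f j x|.
have SL s : S s \in Lfun mu p%:E.
  elim: s => [|j s IHs].
    rewrite (_ : S [::] = 0).
      exact: (Lfun_addr_closed mu (p1 : (1 <= p%:E)%E)).1.
    by apply/funext => x; rewrite /S big_nil.
  rewrite (_ : S (j :: s) = (lam j \o* (fun x => `|f j x|)) + S s).
    apply: (Lfun_addr_closed mu (p1 : (1 <= p%:E)%E)).2 => //.
    apply: Lfun_scale => //; apply/(Lfun_integral_lty _ _ p1).
    have /(Lfun_integral_lty _ _ p1)[_ foo] := fL j.
    split; first exact: measurableT_comp.
    by under eq_integral do rewrite normr_id.
  by apply/funext => x; rewrite /S big_cons mulrC.
apply/(Lfun_integral_lty _ _ p1); split => //.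
have /(Lfun_integral_lty _ _ p1)[mSJ] := SL J.
apply: le_lt_trans; apply: ge0_le_integral => //.
- apply/measurable_EFinP; apply: (measurableT_comp (measurable_powR _)) => //.
  exact: measurableT_comp.
- apply/measurable_EFinP; apply: (measurableT_comp (measurable_powR _)) => //.
  exact: measurableT_comp.
- move=> x _; rewrite lee_fin ge0_ler_powR ?nnegrE//.
  exact: le_trans (tauJ _) (ler_norm _).
Qed.

(** The sets depending on countably many coordinates form a sigma-algebra containing the
    cylinders. *)
Lemma Cyl_countable_support (B : set (Cyl R I)) : measurable B ->
  exists J : set I, countable J /\
    forall x y : I -> R, (forall j, J j -> x j = y j) -> B x -> B y.
Proof.
pose supported (B : set (I -> R)) (J : set I) := countable J /\
  forall x y : I -> R, (forall j, J j -> x j = y j) -> B x -> B y.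
apply: (smallest_sub (X := [set B | exists J, supported B J])).
  split=> [|A [J [cJ AJ]]|F /choice[J FJ]].
  - by exists set0; split.
  - exists J; split => // x y xy [_ nAx]; split => // Ay; apply: nAx.
    by apply: AJ Ay => j Jj; rewrite xy.
  - exists (\bigcup_n J n); split.
      by apply: bigcup_countable => // n _; case: (FJ n).
    move=> x y xy [n _ Fx]; exists n => //; have [_ +] := FJ n.
    by move=> /(_ x y); apply => // j Jj; apply: xy; exists n.
move=> _ [i _ [A mA <-]]; exists [set i]; split; first exact: countable1.
by move=> x y xy [_ Ax]; split => //=; rewrite -xy.
Qed.

Lemma measurable_countable_support (f : (I -> R) -> R) :
  measurable_fun [set: Cyl R I] (f : Cyl R I -> R) ->
  exists J : set I, countable J /\
    forall x y : I -> R, (forall j, J j -> x j = y j) -> f x = f y.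
Proof.
move=> mf; have /choice[J JP] : forall q : rat, exists J : set I, countable J /\
    forall x y : I -> R, (forall j, J j -> x j = y j) ->
      ratr q < f x -> ratr q < f y.
  move=> q; apply: (@Cyl_countable_support [set x | ratr q < f x]).
  have := mf measurableT `]ratr q, +oo[%classic (measurable_itv _).
  rewrite setTI; congr measurable; apply/seteqP; split=> x /=;
    by rewrite in_itv/= andbT.
exists (\bigcup_q J q); split.
  by apply: bigcup_countable => // q _; case: (JP q).
have le x y : (forall j, (\bigcup_q J q) j -> x j = y j) -> f x <= f y.
  move=> xy; rewrite leNgt; apply/negP => /rat_in_itvoo[q].
  rewrite in_itv/= => /andP[yq qx]; have [_ JqP] := JP q.
  have : ratr q < f y by apply: JqP qx => j Jj; apply: xy; exists q.
  by rewrite ltNge (ltW yq).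
by move=> x y xy; apply/eqP; rewrite eq_le !le// => j Jj; rewrite xy.
Qed.

Lemma nneseries_half_lty (f : nat -> R) (N : nat) : (forall n, 0 <= f n) ->
  (forall n, (N <= n)%N -> f n <= 2^-1 ^+ n) -> (\sum_(n <oo) (f n)%:E < +oo)%E.
Proof.
(* The sum in [C] absorbs the first [N] terms; the [2] offsets the exponent [n + 1] of the geometric
   series. *)
move=> f0 fN; pose C : R := 2 + \sum_(k < N) f k * 2 ^+ k.+1.
have fC n : f n <= C / (2 ^ (n + 1))%:R.
  rewrite natrX addn1 ler_pdivlMr ?exprn_gt0// /C.
  have [nN|nN] := ltnP n N.
    rewrite (bigD1 (Ordinal nN))//= addrCA lerDl addr_ge0// sumr_ge0// => k _.
    by rewrite mulr_ge0// exprn_ge0.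
  apply: (@le_trans _ _ 2).
    apply: (@le_trans _ _ (2^-1 ^+ n * 2 ^+ n.+1)).
      by rewrite ler_wpM2r ?exprn_ge0// fN.
    by rewrite exprS mulrCA -exprMn mulVf// expr1n mulr1.
  by rewrite lerDl sumr_ge0// => k _; rewrite mulr_ge0// exprn_ge0.
apply: (@le_lt_trans _ _ (\sum_(n <oo) (C / (2 ^ (n + 1))%:R)%:E)%E).
  by apply: lee_nneseries => n _; rewrite lee_fin.
have /cvg_lim := @cvg_geometric_eseries_half R C 0.
by rewrite /eseries/= => ->//; exact: ltry.
Qed.

Lemma integral_weighted_nat (w : nat -> {nonneg R}) (f : nat -> R) :
  (forall n, 0 <= f n) ->
  (\int[mseries (fun n => mscale (w n) (\d_ n)) 0]_n (f n)%:E =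
   \sum_(n <oo) ((w n)%:num * f n)%:E)%E.
Proof.
move=> f0; have mf : measurable_fun [set: nat] (EFin \o f) by [].
rewrite (@ge0_integral_measure_series _ _ R _ setT)//; last first.
  by move=> n _; rewrite lee_fin.
apply: eq_eseriesr => n _; rewrite ge0_integral_mscale//; last first.
  by move=> k _; rewrite lee_fin.
by rewrite integral_dirac// diracT mul1e EFinM.
Qed.

End Integrability.

(** * From preservation of integrability to the bound defining [Ft R I] *)

Section PreservedIntegrability.
Context (R : realType) (I : Type).

(** On [Cyl R I] with the zero measure the projections are p-integrable, and composing [tau] with
    them gives [tau] itself. *)
Lemma preserves_p_integrability_measurable (p : R) (tau : (I -> R) -> R) :
  1 <= p -> preserves_p_integrability p tau ->
  measurable_fun [set: Cyl R I] (tau : Cyl R I -> R).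
Proof.
move=> p1 tauP; suff: (tau : Cyl R I -> R) \in Lfun (@mzero _ (Cyl R I) R) p%:E.
  by move=> /(Lfun_integral_lty _ _ p1)[].
apply: (tauP _ (Cyl R I) _ (fun i x => x i)) => i.
apply/Lfun_integral_lty => //; split.
  by have := valP (Ft_proj R i); rewrite inE => -[].
by rewrite integral_measure_zero ltry.
Qed.

(* Failing every bound [2 ^ n * \sum_(code j < n) `|x j|] at a point [y n],
   one weighs [y n] by [`|tau (y n)| `^ (- p)]. Each coordinate is then
   summable, being eventually dominated by [2 ^- n], while [tau]
   contributes [1] at every point. *)
Lemma preserves_p_integrability_Ft (p : R) (tau : (I -> R) -> R) : 1 <= p ->
  preserves_p_integrability p tau -> Ft_set R I tau.
Proof.
move=> p1 tauP; have mtau := preserves_p_integrability_measurable p1 tauP.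
split => //; have [J [cJ tauJ]] := measurable_countable_support mtau.
have /countable_injP[code codeJ] := cJ.
pose K n : set {classic I} := [set j | J j /\ (code j < n)%N].
have finK n : finite_set (K n).
  have /eq_finite_set <- : (code @` K n #= K n)%card.
    apply: inj_card_eq => i j /set_mem[Ji _] /set_mem[Jj _].
    by apply: codeJ; rewrite inE.
  by apply: sub_finite_set (finite_II n) => _ [j [_ jn] <-].
apply: contrapT => unbounded.
have /choice[x xP] : forall n, exists x : I -> R,
    \sum_(j <- fset_set (K n)) 2 ^+ n * `|x j| < `|tau x|.
  move=> n; apply: contra_notP unbounded => /forallNP xn.
  exists (fset_set (K n)), (fun=> 2 ^+ n); split => [j _|z].
    by rewrite exprn_ge0.
  by rewrite leNgt; apply/negP.
(* Coordinates outside [J] are set to [0], which makes them integrable and leaves [tau]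
   unchanged. *)
pose y n i := if `[< J i >] then x n i else 0.
have tauy n : tau (y n) = tau (x n).
  by apply: tauJ => j Jj; rewrite /y asboolT.
have t0 n : 0 < `|tau (y n)|.
  rewrite tauy; apply: le_lt_trans (xP n); apply: sumr_ge0 => j _.
  by rewrite mulr_ge0// exprn_ge0.
pose w n : {nonneg R} := NngNum (powR_ge0 `|tau (y n)| (- p)).
pose mu := mseries (fun n => mscale (w n) (\d_ n)) 0.
have wE n (r : R) : 0 <= r -> (w n)%:num * r `^ p = (r / `|tau (y n)|) `^ p.
  move=> r0; rewrite mulrC powRM// ?invr_ge0//.
  by rewrite -powR_inv1// -powRrM mulN1r.
have p0 : 0 <= p by exact: le_trans p1.
have fL i : (fun n => y n i) \in Lfun mu p%:E.
  apply/Lfun_integral_lty => //; split => //.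
  rewrite integral_weighted_nat => [|n]; last exact: powR_ge0.
  (* For [n > code i], an [i] in [J] belongs to [K n], so [|y n i|] is at most [2 ^- n] times
     [|tau (y n)|]; the p-th power of [2 ^- n] is at most [2 ^- n] because [p >= 1]. *)
  apply: (@nneseries_half_lty _ _ (code i).+1) => [n|n ni].
    by rewrite mulr_ge0// powR_ge0.
  rewrite wE//; apply: (@le_trans _ _ ((2^-1 ^+ n) `^ p)); last first.
    apply: ge1r_powR => //; rewrite exprn_gt0//= exprn_ile1// invf_le1//.
    by rewrite ler1n.
  rewrite ge0_ler_powR ?nnegrE ?divr_ge0 ?exprn_ge0//.
  rewrite ler_pdivrMr// exprVn ler_pdivlMl ?exprn_gt0// /y.
  case: asboolP => Ji; last by rewrite normr0 mulr0.
  rewrite -/(y n) tauy; apply: le_trans (ltW (xP n)).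
  have iK : (i : {classic I}) \in fset_set (K n).
    by rewrite in_fset_set ?inE.
  rewrite (big_fsetD1 _ iK)/= lerDl; apply: sumr_ge0 => j _.
  by rewrite mulr_ge0// exprn_ge0.
have /(Lfun_integral_lty _ _ p1)[_] := tauP _ _ mu _ fL.
rewrite integral_weighted_nat => [|n]; last exact: powR_ge0.
under eq_eseriesr => n _ do rewrite wE// divff ?gt_eqF// powR1.
(* The series of ones would be a real number above every natural number. *)
move=> oo; have n1 n : (n%:R%:E <= \sum_(k <oo) (1 : R)%:E)%E.
  apply: le_trans (nneseries_lim_ge n (u_ := fun=> 1%:E) (P := xpredT) _).
    by rewrite sumEFin big_const_nat iter_addr_0 subn0.
  by move=> k _ _; rewrite lee_fin.
have : (\sum_(k <oo) (1 : R)%:E)%E \is a fin_num.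
  by rewrite ge0_fin_numE// (le_trans _ (n1 0%N)).
move=> /fineK sE; move: n1; rewrite -sE => n1.
have := n1 (Num.truncn (fine (\sum_(k <oo) (1 : R)%:E)%E)).+1.
by rewrite lee_fin leNgt truncnS_gt.
Qed.

Lemma preserves_p_integrabilityP (p : R) (tau : (I -> R) -> R) : 1 <= p ->
  preserves_p_integrability p tau <-> Ft_set R I tau.
Proof.
move=> p1; split; first exact: preserves_p_integrability_Ft.
exact: Ft_preserves_p_integrability.
Qed.

Lemma preserves_integrabilityP (tau : (I -> R) -> R) :
  preserves_integrability tau <-> Ft_set R I tau.
Proof.
split=> [[p p1 /(preserves_p_integrabilityP _ p1)//]|tauF].
by exists 1 => //; apply/preserves_p_integrabilityP.
Qed.

End PreservedIntegrability.

Theorem corollary10p4 (R : realType) (I : Type) :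
  [/\ (forall (p : R) (tau : (I -> R) -> R), 1 <= p ->
         (preserves_p_integrability p tau <-> preserves_integrability tau)),
      Ft_set R I = [set tau | preserves_integrability tau],
      (forall (f g : Ft R I) (a : R),
         [/\ f <= g <-> (forall x, f x <= g x)
           & forall x : I -> R,
             [/\ (f + g) x = f x + g x, (a *: f) x = a * f x,
                 rmeet f g x = Num.min (f x) (g x),
                 rjoin f g x = Num.max (f x) (g x)
               & trunc f x = Num.min (f x) 1]]),
      sigma_complete (Ft R I)
    & forall (G : truncRieszType R) (h : I -> G), sigma_complete G ->
        exists! phi : Ft R I -> G,
          [/\ riesz_morphism phi, trunc_preserving phi, sigma_continuous phi
            & forall i : I, phi (Ft_proj R i) = h i]].
Proof.
split.
- move=> p tau p1.
  by rewrite preserves_p_integrabilityP// preserves_integrabilityP.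
- by apply/funext => tau; apply/propext; rewrite /= preserves_integrabilityP.
- by move=> f g a; split => //; rewrite Ft_le; split => /asboolP.
- exact: Ft_sigma_complete.
- move=> G h sG; exists (Ft_lift h); split.
    split; [exact: riesz_morphism_Ft_lift|exact: trunc_preserving_Ft_lift|
      exact: sigma_continuous_Ft_lift|exact: Ft_lift_proj].
  by move=> psi [? ? ? ?]; exact: Ft_lift_unique.
Qed.
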